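(* Let $\mathcal{G}(\mathcal{V},\mathcal{E},\bm{A},\bm{\tau})$ be a delay-embedded graph. If the delay-embedded signed Laplacian $\widehat{\bm{L}}_\tau$ is positive semi-definite with a simple zero eigenvalue, then the system $$\dot{x}_i(t)=\sum_{j=1}^n a_{ij}\bigl(x_j(t-\tau_{ij})-x_i(t-\tau_{ij})\bigr),\qquad i=1,\dots,n,$$ reaches an average consensus.
   Context: Delay-embedded graph: $\mathcal{G}(\mathcal{V},\mathcal{E},\bm{A},\bm{\tau})$ is a connected weighted undirected graph with node set $\mathcal{V}=\{1,\dots,n\}$ and edge set $\mathcal{E}$ (unordered pairs $(i,j)$, $i\ne j$). $\bm{A}=[a_{ij}]\in\mathbb{R}^{n\times n}$ is the weighted adjacency matrix: $a_{ii}=0$; $a_{ij}=a_{ji}$ is the weight (positive or negative) of the edge $(i,j)\in\mathcal{E}$; $a_{ij}=0$ if $(i,j)\notin\mathcal{E}$. $\bm{\tau}=[\tau_{ij}]\in\mathbb{R}^{n\times n}$ is the delay matrix: $\tau_{ii}=0$; $\tau_{ij}=\tau_{ji}\ge 0$ is the delay of the edge $(i,j)\in\mathcal{E}$ (arbitrarily large values allowed); $\tau_{ij}=0$ if $(i,j)\notin\mathcal{E}$. Laplacian of edge values $w_{ij}=w_{ji}$ (with $w_{ij}=0$ if $(i,j)\notin\mathcal{E}$): the real symmetric matrix with diagonal entries $\sum_{j\ne i}w_{ij}$ and off-diagonal entries $-w_{ij}$. $\bm{L}_0$ is the Laplacian with $w_{ij}=a_{ij}$; $\bm{L}_0^{\mathrm{abs}}$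 is the Laplacian with $w_{ij}=|a_{ij}|$; $\overline{\lambda}=\lambda_{\max}(\bm{L}_0^{\mathrm{abs}})$ is its largest eigenvalue. Standing assumption: $\bm{L}_0$ is positive semi-definite with a simple zero eigenvalue. Delay-embedded signed Laplacian: $\widehat{\bm{L}}_\tau\in\mathbb{R}^{n\times n}$ is the Laplacian with edge values, for $(i,j)\in\mathcal{E}$, - $w_{ij}=a_{ij}$ if $a_{ij}>0$, $\tau_{ij}=0$; - $w_{ij}=a_{ij}e^{-\tau_{ij}\overline{\lambda}}\cos(\tau_{ij}\overline{\lambda})$ if $a_{ij}>0$, $0<\tau_{ij}\overline{\lambda}<\frac{\pi}{2}$; - $w_{ij}=a_{ij}\cos(\tau_{ij}\overline{\lambda})$ if $a_{ij}>0$, $\frac{\pi}{2}\le\tau_{ij}\overline{\lambda}<\pi$; - $w_{ij}=-a_{ij}$ if $a_{ij}>0$, $\tau_{ij}\overline{\lambda}\ge\pi$; - $w_{ij}=a_{ij}$ if $a_{ij}<0$. Solutions: $\bm{x}(t)=[x_i(t)]\in\mathbb{R}^n$ is continuous on $[0,\infty)$ with arbitrary initial value $\bm{x}(0)$, satisfies the equation for almost every $t\ge0$, with $x_i(t)=0$ for $t<0$ (so that its Laplace transform $\bm{X}(s)$ satisfies $sX_i(s)-x_i(0)=\sum_j a_{ij}e^{-\tau_{ij}s}(X_j(s)-X_i(s))$). The system reaches an average consensus if, for every $\bm{x}(0)$, $\lim_{t\to\infty}\bm{x}(t)=c\bm{1}_n$ with $c=\frac1n\bm{1}_n^T\bm{x}(0)$,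 where $\bm{1}_n$ is the all-ones vector.
   Formalization: Solutions are required to be locally absolutely continuous on [0,∞), not merely continuous and satisfying the equation almost everywhere; otherwise, for a single node, the Cantor function would be a solution violating consensus. This is what the Laplace-transform identity presupposes. *)

(* Defs.v *)
From HB Require Import structures.
From mathcomp Require Import all_boot all_order all_algebra.
From mathcomp Require Import all_classical all_reals all_analysis.
Set Implicit Arguments.
Unset Strict Implicit.
Unset Printing Implicit Defensive.
Import Order.TTheory GRing.Theory Num.Theory.
Import numFieldNormedType.Exports.
Local Open Scope classical_set_scope.
Local Open Scope ring_scope.

(* Nodes are numbered from 0. An edge weight may have either sign but is not
   zero; [A] and [tau] vanish off the edges, in particular on the diagonal. *)
Record delay_graph (R : realType) (n : nat) := DelayGraph {
  edge : rel 'I_n;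
  adj : 'M[R]_n;
  delay : 'M[R]_n;
  edge_irr : irreflexive edge;
  edge_sym : symmetric edge;
  edge_connected : forall i j, connect edge i j;
  adj_sym : forall i j, adj i j = adj j i;
  adj_edge : forall i j, edge i j -> adj i j != 0;
  adj_nonedge : forall i j, ~~ edge i j -> adj i j = 0;
  delay_sym : forall i j, delay i j = delay j i;
  delay_ge0 : forall i j, 0 <= delay i j;
  delay_nonedge : forall i j, ~~ edge i j -> delay i j = 0
}.

Section Matrices.
Context {R : realType} {n : nat}.
Implicit Types (w : 'I_n -> 'I_n -> R) (M : 'M[R]_n).

Definition laplacian w : 'M[R]_n :=
  \matrix_(i, j) if i == j then \sum_(k | k != i) w i k else - w i j.

(* Only applied to symmetric matrices. *)
Definition psd M : Prop := forall v : 'cV[R]_n, 0 <= (v^T *m M *m v) 0 0.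

Definition simple_zero_eigenvalue M : Prop := mup 0 (char_poly M) = 1%N.

(* The spectrum is finite, so this supremum is a maximum as soon as there is a
   real eigenvalue, which is the case for a symmetric matrix of size n > 0. *)
Definition lambda_max M : R := sup [set a | eigenvalue M a].

End Matrices.

Section DelayLaplacian.
Context {R : realType} {n : nat} (G : delay_graph R n).

Definition L0 : 'M[R]_n := laplacian (adj G).

Definition L0_abs : 'M[R]_n := laplacian (fun i j => `|adj G i j|).

Definition lambda_bar : R := lambda_max L0_abs.

Definition delay_weight (i j : 'I_n) : R :=
  let a := adj G i j in
  let tau := delay G i j in
  let theta := tau * lambda_bar in
  if ~~ edge G i j then 0
  else if a < 0 then a
  else if tau == 0 then a
  else if theta < pi / 2 then a * expR (- theta) * cos theta
  else if theta < pi then a * cos theta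
  else - a.

Definition L_tau : 'M[R]_n := laplacian delay_weight.

End DelayLaplacian.

(* Absolute continuity of [f] on [a, b]: the members of [s] are the end points
   of finitely many non-overlapping subintervals. *)
Definition abs_continuous {R : realType} (a b : R) (f : R -> R) : Prop :=
  forall e : R, 0 < e -> exists2 d : R, 0 < d &
    forall s : seq (R * R),
      (forall p, p \in s -> a <= p.1 /\ p.1 <= p.2 /\ p.2 <= b) ->
      pairwise (fun p q : R * R => (p.2 <= q.1) || (q.2 <= p.1)) s ->
      \sum_(p <- s) (p.2 - p.1) < d ->
      \sum_(p <- s) `|f p.2 - f p.1| < e.

Section Consensus.
Context {R : realType} {n : nat} (G : delay_graph R n).

Definition delay_rhs (x : R -> 'cV[R]_n) (t : R) (i : 'I_n) : R :=
  \sum_j adj G i j * (x (t - delay G i j) j 0 - x (t - delay G i j) i 0).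

(* Local absolute continuity is what makes the equation almost everywhere
   equivalent to its integral (hence Laplace-transformed) form; with continuity
   alone, a Cantor function would solve x' = 0. *)
Record delay_solution (x : R -> 'cV[R]_n) : Prop := DelaySolution {
  sol_history : forall t, t < 0 -> x t = 0;
  sol_continuous : {within `[0, +oo[, continuous x};
  sol_abs_continuous : forall i (T : R), 0 < T ->
    abs_continuous 0 T (fun t => x t i 0);
  sol_equation : {ae lebesgue_measure, forall t : R, 0 <= t ->
    forall i, is_derive t 1 (fun u => x u i 0) (delay_rhs x t i)}
}.

Definition reaches_average_consensus : Prop :=
  forall (x0 : 'cV[R]_n) (x : R -> 'cV[R]_n),
    delay_solution x -> x 0 = x0 ->
    x t @[t --> +oo] --> (const_mx (n%:R^-1 * \sum_i x0 i 0) : 'cV[R]_n).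

End Consensus.

(* Main.v *)
Require Import Defs.
From mathcomp Require Import all_boot all_order all_algebra.
From mathcomp Require Import all_classical all_reals all_analysis.
From mathcomp Require Import measurable_realfun complex ring lra zify.
Set Implicit Arguments.
Unset Strict Implicit.
Unset Printing Implicit Defensive.
Import Order.TTheory GRing.Theory Num.Theory.
Import numFieldNormedType.Exports.
Local Open Scope classical_set_scope.
Local Open Scope ring_scope.

(** Why the theorem holds. Let [y] be the solution minus the average of its
    initial value. Its Laplace transform satisfies [(s + L(s)) Y(s) = y(0)], where
    [L(s)] is the Laplacian with edge values [a_ij exp(- s tau_ij)], and the form
    [v^* (s + L(s)) v] is bounded away from 0 on unit vectors [v] orthogonal to the
    all-ones vector, uniformly in the half-plane [Re s >= 0]. When [|s|] exceeds
    [lambda_bar] the term [s |v|^2] dominates, because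
    [|v^* L(s) v| <= v^* L0_abs v <= lambda_bar |v|^2]. When [|s|] does not exceed
    [lambda_bar], the real part of [a_ij exp(- s tau_ij)] is at least the edge value
    of [L_tau] (this is what the case distinction defining [L_tau] computes), so the
    real part of the form is at least [v^* L_tau v >= c |v|^2]. The inverse is thus
    bounded in the closed half-plane, and Plancherel turns this into square
    integrability, hence decay.

    The argument is carried out on samples of the solution. With a time step
    [delta], an implicit difference quotient and delays rounded down to the grid, the
    quotient [(1 - w) / delta] with [|w| <= 1] takes the place of [s] and [w ^+ m] that
    of [exp(- s tau)]; the two cases above survive with a margin that does not depend
    on [delta] ([symbol_bound]). Plancherel becomes the Parseval identity for the
    [N]-th roots of unity, which bounds a finite sequence by its defect in the
    difference scheme ([scheme_energy]). If [M k] is the supremum of [|y|] over the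
    [k]-th grid cell, the equation bounds both the defect of the samples and the
    difference between [M k] and the samples by [delta] times nearby values of [M]
    ([solution_envelope]). For [delta] small but fixed these errors are absorbed by
    the Parseval estimate, so no limit in [delta] is taken.

    Parseval needs finite sequences. Cutting at time [T] costs the energy near [T],
    so what results for [S r T = \sum_(k < T) (r ^+ k * M k) ^+ 2] is only
    [S r T <= C1 + C2 * (S r T - S r (T - H))], which exponential growth satisfies
    too. But [C1] and [C2] serve all [r] in [[0, 1]], since the whole disc
    [|w| <= r <= 1] is available, and therefore each [S r] is either at most [C1] or
    grows at least at a rate that does not depend on [r]. For small [r] it is
    bounded, [M] growing at most exponentially; raising [r] to 1 by factors too
    small to create the forbidden rate keeps it bounded ([energy_sweep]). Hence the
    squares of [M] are summable and [M] tends to 0 ([discrete_decay]).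

    The equation enters only through increments: an absolutely continuous function
    whose derivative is almost everywhere within [e] of [c] has increments within
    [e (t - s)] of [c (t - s)] ([ae_derive_mean_value]). *)

(** * Increments of absolutely continuous functions *)

Lemma is_derive_linear_approx (R : realType) (f : R -> R) (t l eps : R) :
  0 < eps -> is_derive t 1 f l ->
  exists2 r : R, 0 < r & forall u, `|u - t| < r ->
    `|f u - f t - l * (u - t)| <= eps * `|u - t|.
Proof.
move=> eps0 [df <-].
have /cvgrPdist_le/(_ _ eps0) : (fun h => h^-1 *: (f (h *: 1 + t) - f t)) @ 0^' --> 'D_1 f t := df.
rewrite near_withinE => /nbhs_ballP[r /= r0 rP].
exists r => // u ut; have [->|utN] := eqVneq u t; first by rewrite !subrr mulr0 subrr normr0 mulr0.
have ut0 : u - t != 0 by rewrite subr_eq0.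
have := rP (u - t); rewrite /ball /= sub0r normrN => /(_ ut ut0).
rewrite /GRing.scale /= mulr1 subrK => h.
have -> : f u - f t - 'D_1 f t * (u - t) = - (('D_1 f t - (u - t)^-1 * (f u - f t)) * (u - t)).
  by rewrite mulrBl mulrAC mulVf // mul1r; ring.
by rewrite normrN normrM ler_wpM2r.
Qed.

(** For a tag inside an interval the two one-sided errors add up without loss,
    which is why tagged intervals suffice in the covering argument below. *)
Lemma straddle (R : realDomainType) (f : R -> R) (c e t r : R) :
  (forall u, `|u - t| < r -> `|f u - f t - c * (u - t)| <= e * `|u - t|) ->
  forall u v, u <= t -> t <= v -> t - r < u -> v < t + r ->
  `|f v - f u - c * (v - u)| <= e * (v - u).
Proof.
move=> h u v ut tv ur vr.
have := h u; rewrite ler0_norm ?subr_le0 // => /(_ ltac:(lra)) hu.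
have := h v; rewrite ger0_norm ?subr_ge0 // => /(_ ltac:(lra)) hv.
have -> : f v - f u - c * (v - u) = (f v - f t - c * (v - t)) - (f u - f t - c * (u - t)) by ring.
by apply: le_trans (ler_normB _ _) _; apply: le_trans (lerD hv hu) _; lra.
Qed.

(** A covering argument in the style of Cousin's lemma. Fix an open set [U] of
    small measure containing the exceptional null set. Starting from [a], advance
    by intervals that are either good (the increment is almost [c] times the
    length) or contained in [U]. Around each point one of the two kinds is
    available, so the supremum of the reachable points is [b]; absolute
    continuity makes the total increment over the intervals inside [U] small. *)
Lemma ae_derive_mean_value (R : realType) (f g : R -> R) (a b c e : R) :
  a <= b -> abs_continuous a b f ->
  {ae lebesgue_measure, forall t : R, a <= t <= b -> is_derive t 1 f (g t)} ->
  (forall t, a <= t <= b -> `|g t - c| <= e) ->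
  `|f b - f a - c * (b - a)| <= e * (b - a).
Proof.
move=> ab fAC [N [mN N0 badN]] gc.
apply/ler_addgt0Pr => eta eta0.
pose eps := eta / (b - a + 2).
have eps0 : 0 < eps by rewrite divr_gt0 //; lra.
have [d d0 dP] := fAC _ eps0.
(* The measure of [U] must also be small compared with [1 / |c|], as the drift
   [c * (t - s)] is subtracted on the intervals inside [U] too. *)
pose d' := Num.min d (eps / (`|c| + 1)).
have c10 : 0 < `|c| + 1 by rewrite ltr_wpDl.
have d'0 : 0 < d' by rewrite lt_min d0 divr_gt0.
have [U [oU NU Ud]] : exists U : set R, [/\ open U, N `<=` U &
    (lebesgue_measure U < d'%:E)%E].
  have [|U [oU NU Ud]] := lebesgue_regularity_outer mN _ d'0; first by rewrite [X in (X < _)%E]N0.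
  exists U; split => //.
  have mU : measurable U by exact: open_measurable.
  rewrite -(setDUK NU) measureU //; last 2 first.
  - exact: measurableD.
  - by rewrite setDIK.
  by rewrite [X in (X + _ < _)%E]N0 add0e.
have mU : measurable U by exact: open_measurable.
(* Recording the length of the bad intervals as at most the measure of [U] to the
   left of [t] avoids the measure of their union. *)
pose Q (t : R) := a <= t <= b /\ exists s : seq (R * R),
  [/\ forall p, p \in s -> a <= p.1 /\ p.1 <= p.2 /\ p.2 <= t,
      pairwise (fun p q : R * R => (p.2 <= q.1) || (q.2 <= p.1)) s,
      ((\sum_(p <- s) (p.2 - p.1))%:E <= lebesgue_measure (U `&` `[a, t[))%E &
      `|f t - f a - c * (t - a)| <= (e + eps) * (t - a)
         + \sum_(p <- s) (`|f p.2 - f p.1| + `|c| * (p.2 - p.1))].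
have Qa : Q a.
  split; first by rewrite lexx.
  exists [::]; split => //; rewrite !big_nil //.
  by rewrite !subrr !mulr0 subrr normr0 addr0.
have step t t' : Q t -> t <= t' -> t' <= b ->
    (`|f t' - f t - c * (t' - t)| <= (e + eps) * (t' - t) \/ `[t, t'] `<=` U) -> Q t'.
  move=> [/andP[a_t tb] [s [sin sdis slen sest]]] tt' t'b.
  have split_f : f t' - f a - c * (t' - a) = (f t' - f t - c * (t' - t)) + (f t - f a - c * (t - a)).
    by ring.
  case=> [good|tU]; (split; first by rewrite (le_trans a_t)).
    exists s; split => //.
    - by move=> p /sin[? [? ?]]; do !split => //; exact: le_trans tt'.
    - apply: le_trans slen _; apply: le_measure; rewrite ?inE; try exact: measurableI.
      by apply: setIS; apply: subset_itvl; rewrite bnd_simp.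
    - rewrite split_f; apply: le_trans (ler_normD _ _) _.
      by apply: le_trans (lerD good sest) _; lra.
  exists ((t, t') :: s); split.
  - move=> p; rewrite inE => /orP[/eqP->|/sin[? [? ?]]] //=.
    by do !split => //; exact: le_trans tt'.
  - rewrite /= sdis andbT; apply/allP => p /sin[_ [_ pt]] /=.
    by rewrite pt orbT.
  - rewrite big_cons /= EFinD.
    have -> : U `&` `[a, t'[ = `[t, t'[ `|` (U `&` `[a, t[).
      apply/seteqP; split=> x /=; rewrite !in_itv /=.
        by move=> [Ux /andP[ax xt']]; case: (leP t x) => tx; [left|right]; rewrite ?ax ?xt'.
      case=> [/andP[tx xt']|[Ux /andP[ax xt]]]; last by rewrite ax (lt_le_trans xt).
      by rewrite xt' (le_trans a_t) //; split => //; apply: tU; rewrite /= in_itv /= tx ltW.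
    rewrite measureU //; last 2 first.
    - exact: measurableI.
    - apply/seteqP; split=> x //=; rewrite !in_itv /= => -[/andP[tx _] [_ /andP[_ xt]]].
      by move: (le_lt_trans tx xt); rewrite ltxx.
    apply: leeD => //; rewrite [leRHS](lebesgue_measure_itv `[t, t'[) /= lte_fin.
    case: ltP => [_|t't]; first by rewrite EFinB lexx.
    by rewrite lee_fin subr_le0.
  - rewrite split_f big_cons /=; apply: le_trans (ler_normD _ _) _.
    have h : `|f t' - f t - c * (t' - t)| <= `|f t' - f t| + `|c| * (t' - t).
      apply: le_trans (ler_normB _ _) _.
      by rewrite normrM (ger0_norm (x := t' - t)) ?subr_ge0.
    have ee : 0 <= (e + eps) * (t' - t).
      rewrite mulr_ge0 ?subr_ge0 // addr_ge0 ?(ltW eps0) //.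
      by apply: le_trans (gc a _); rewrite ?lexx.
    by apply: le_trans (lerD h sest) _; lra.
have local t : a <= t <= b -> exists2 r, 0 < r & forall u v, u <= t -> t <= v ->
    t - r < u -> v < t + r ->
    `|f v - f u - c * (v - u)| <= (e + eps) * (v - u) \/ `[u, v] `<=` U.
  move=> tab; have [Ut|Ut] := pselect (U t).
    have /nbhs_ballP[r /= r0 rU] := oU _ Ut.
    exists r => // u v ut tv ur vr; right => x /=; rewrite in_itv /= => /andP[ux xv].
    by apply: rU; rewrite /ball /= ltr_distlC; apply/andP; split; lra.
  have dt : is_derive t 1 f (g t).
    apply: contrapT => nd; apply/Ut/NU/badN => /= h; exact/nd/h.
  have [r r0 rP] := is_derive_linear_approx eps0 dt.
  exists r => // u v ut tv ur vr; left.
  apply: (@straddle _ f c (e + eps) t r) => // w wt.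
  have -> : f w - f t - c * (w - t) = (f w - f t - g t * (w - t)) + (g t - c) * (w - t) by ring.
  apply: le_trans (ler_normD _ _) _; rewrite addrC [leRHS]mulrDl lerD ?rP //.
  by rewrite normrM ler_wpM2r // gc.
have Qb : Q b.
  pose sg := sup [set t | Q t].
  have hs : has_sup [set t | Q t].
    by split; [exists a | exists b => t [/andP[]]].
  have asg : a <= sg by apply: ub_le_sup => //; exact: hs.2.
  have sgb : sg <= b by apply: ge_sup; [exact: hs.1 | move=> t [/andP[]]].
  have [|r r0 rP] := local sg; first by rewrite asg.
  have [t Qt tsg] : exists2 t, Q t & sg - r < t.
    exact: sup_adherent.
  have tsg' : t <= sg by apply: ub_le_sup => //; exact: hs.2.
  pose t' := Num.min (sg + r / 2) b.
  have sgt' : sg <= t' by rewrite le_min sgb andbT; lra.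
  have t'r : t' < sg + r by rewrite gt_min; apply/orP; left; lra.
  have t'b : t' <= b by rewrite ge_min lexx orbT.
  have Qt' : Q t'.
    by apply: (step t) => //; [exact: le_trans sgt' | exact: rP].
  have t'sg : t' <= sg by apply: ub_le_sup => //; exact: hs.2.
  suff <- : t' = b by [].
  by move: t'sg; rewrite /t' minElt; case: ifP => //; lra.
case: Qb => _ [s [sin sdis slen sest]].
have slt : \sum_(p <- s) (p.2 - p.1) < d'.
  rewrite -lte_fin; apply: le_lt_trans slen _; apply: le_lt_trans Ud.
  by apply: le_measure; rewrite ?inE //; exact: measurableI.
apply: le_trans sest _; rewrite big_split /= -mulr_sumr.
have [d'd d'e] : d' <= d /\ d' <= eps / (`|c| + 1) by rewrite !ge_min !lexx orbT.
have h1 := dP s sin sdis (lt_le_trans slt d'd).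
have h2 : `|c| * (\sum_(p <- s) (p.2 - p.1)) <= eps.
  have /ltW := lt_le_trans slt d'e.
  rewrite ler_pdivlMr // => h.
  apply: le_trans h; rewrite mulrDr mulr1 mulrC lerDl big_seq.
  by apply: sumr_ge0 => p /sin[_ [? _]]; rewrite subr_ge0.
have -> : eta = eps * (b - a + 2) by rewrite /eps divfK //; lra.
lra.
Qed.

Lemma abs_continuous_sub (R : realType) (a b a' b' : R) f :
  a <= a' -> b' <= b -> abs_continuous a b f -> abs_continuous a' b' f.
Proof.
move=> aa bb fAC e e0; have [d d0 dP] := fAC _ e0; exists d => // s sin; apply: dP.
move=> p /sin[h1 [h2 h3]]; split; [exact: le_trans h1 | split => //; exact: le_trans bb].
Qed.

Lemma abs_continuous_sum (R : realType) (I : finType) (a b : R) (F : I -> R -> R) :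
  (forall i, abs_continuous a b (F i)) -> abs_continuous a b (fun t => \sum_i F i t).
Proof.
move=> FAC; suff : forall s : seq I, abs_continuous a b (fun t => \sum_(i <- s) F i t) by apply.
elim=> [|i s IH] e e0.
  exists 1 => // p _ _ _; rewrite big1 // => q _.
  by rewrite !big_nil subrr normr0.
have e20 : 0 < e / 2 by rewrite divr_gt0.
have [d1 d10 dP1] := FAC i _ e20; have [d2 d20 dP2] := IH _ e20.
exists (Num.min d1 d2); first by rewrite lt_min d10.
move=> p pin pdis; rewrite lt_min => /andP[pl1 pl2].
have := dP1 p pin pdis pl1; have := dP2 p pin pdis pl2.
set X := \sum_(q <- p) _; set Y := \sum_(q <- p) _ => hX hY.
apply: le_lt_trans (_ : Y + X < _); last by lra.
rewrite /Y /X -big_split; apply: ler_sum => q _ /=.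
rewrite !big_cons; apply: le_trans (ler_normD _ _).
by rewrite le_eqVlt; apply/orP; left; apply/eqP; congr (`| _ |); ring.
Qed.

(** * Quadratic forms and Laplacians *)

Lemma mx_norm_le (R : realType) (m n : nat) (v : 'M[R]_(m, n)) (e : R) :
  0 <= e -> (forall i j, `|v i j| <= e) -> `|v| <= e.
Proof.
move=> e0 ve; rewrite [leLHS]/Num.norm /= mx_normrE.
by apply/bigmax_leP; split=> //= -[i j] _; exact: ve.
Qed.

Definition sqnorm {R : realType} {n : nat} (v : 'cV[R]_n) : R := \sum_i v i 0 ^+ 2.

Definition qform {R : realType} {n : nat} (M : 'M[R]_n) (v : 'cV[R]_n) : R :=
  (v^T *m M *m v) 0 0.

Lemma qformE (R : realType) (n : nat) (M : 'M[R]_n) (v : 'cV[R]_n) :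
  qform M v = \sum_i \sum_j v i 0 * M i j * v j 0.
Proof.
rewrite /qform mxE exchange_big /=; apply: eq_bigr => j _.
by rewrite !mxE mulr_suml; apply: eq_bigr => i _; rewrite !mxE.
Qed.

Lemma sqnorm_ge0 (R : realType) (n : nat) (v : 'cV[R]_n) : 0 <= sqnorm v.
Proof. by apply: sumr_ge0 => i _; rewrite sqr_ge0. Qed.

Lemma sqnorm_eq0 (R : realType) (n : nat) (v : 'cV[R]_n) : (sqnorm v == 0) = (v == 0).
Proof.
apply/idP/eqP => [|->]; last by rewrite /sqnorm big1 // => i _; rewrite mxE expr0n.
rewrite psumr_eq0 => [/allP h|i _]; last exact: sqr_ge0.
apply/colP => i; rewrite mxE; apply/eqP.
by have := h i (mem_index_enum _); rewrite sqrf_eq0.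
Qed.

Lemma sqnormZ (R : realType) (n : nat) (a : R) (v : 'cV[R]_n) :
  sqnorm (a *: v) = a ^+ 2 * sqnorm v.
Proof. by rewrite /sqnorm mulr_sumr; apply: eq_bigr => i _; rewrite mxE exprMn. Qed.

Lemma qformZ (R : realType) (n : nat) (M : 'M[R]_n) (a : R) (v : 'cV[R]_n) :
  qform M (a *: v) = a ^+ 2 * qform M v.
Proof.
by rewrite /qform -scalemxAr linearZ /= -!scalemxAl mxE mxE mulrA expr2.
Qed.

Lemma qform_scalar (R : realType) (n : nat) (a : R) (v : 'cV[R]_n) :
  qform a%:M v = a * sqnorm v.
Proof.
rewrite /qform mul_mx_scalar -scalemxAl !mxE; congr (_ * _).
by apply: eq_bigr => i _; rewrite mxE expr2.
Qed.

Lemma qformB (R : realType) (n : nat) (M N : 'M[R]_n) (v : 'cV[R]_n) :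
  qform (M - N) v = qform M v - qform N v.
Proof. by rewrite /qform mulmxBr mulmxBl !mxE. Qed.

Lemma qformN (R : realType) (n : nat) (M : 'M[R]_n) (v : 'cV[R]_n) :
  qform (- M) v = - qform M v.
Proof. by rewrite /qform mulmxN mulNmx !mxE. Qed.

(** Compactness of the unit sphere of the hyperplane orthogonal to [l]; taking
    [l = 0] gives the sphere of the whole space. *)
Lemma qform_min_on_hyperplane (R : realType) (n : nat) (M : 'M[R]_n) (l : 'cV[R]_n) :
  (exists2 v : 'cV[R]_n, v != 0 & \sum_i l i 0 * v i 0 = 0) ->
  exists v : 'cV[R]_n, [/\ sqnorm v = 1, \sum_i l i 0 * v i 0 = 0 &
    forall z : 'cV[R]_n, \sum_i l i 0 * z i 0 = 0 -> qform M v * sqnorm z <= qform M z].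
Proof.
move=> [v0 v0N0 lv0].
pose ccomb (r : 'rV[R]_n) := \sum_i l i 0 * r 0 i.
pose csq (r : 'rV[R]_n) := \sum_i r 0 i ^+ 2.
pose cq (r : 'rV[R]_n) := \sum_i \sum_j r 0 i * M i j * r 0 j.
have ccoord i : continuous (fun r : 'rV[R]_n => r 0 i) by exact: coord_continuous.
have csum (F : 'I_n -> 'rV[R]_n -> R) :
    (forall i, continuous (F i)) -> continuous (fun r => \sum_i F i r).
  by move=> cF; apply: continuous_big => [|i _]; [exact: add_continuous | exact: cF].
have cmul (f g : 'rV[R]_n -> R) :
    continuous f -> continuous g -> continuous (fun r => f r * g r).
  by move=> cf cg r; exact: (cvgM (cf r) (cg r)).
have ccst (a : R) : continuous (fun _ : 'rV[R]_n => a) by exact: cst_continuous.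
have ccombC : continuous ccomb by apply: csum => i; apply: cmul; [exact: ccst | exact: ccoord].
have csqC : continuous csq.
  by apply: csum => i; rewrite (_ : (fun r : 'rV[R]_n => _) = fun r => r 0 i * r 0 i);
    [by apply: cmul; exact: ccoord | by apply/funext => r; rewrite expr2].
have cqC : continuous cq.
  by apply: (csum) => i; apply: csum => j; apply: (cmul); [|exact: ccoord];
     apply: cmul; [exact: ccoord | exact: ccst].
pose K := [set r : 'rV[R]_n | csq r = 1] `&` [set r | ccomb r = 0].
have sqT r : csq r = sqnorm r^T by apply: eq_bigr => i _; rewrite mxE.
have qT r : cq r = qform M r^T.
  by rewrite qformE; apply: eq_bigr => i _; apply: eq_bigr => j _; rewrite !mxE.
have cT r : ccomb r = \sum_i l i 0 * r^T i 0.
  by apply: eq_bigr => i _; rewrite mxE.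
have scale_in (z : 'cV[R]_n) : z != 0 -> \sum_i l i 0 * z i 0 = 0 ->
    K ((Num.sqrt (sqnorm z))^-1 *: z)^T.
  move=> zN0 lz; split; rewrite /= ?sqT ?cT trmxK.
    rewrite sqnormZ exprVn sqr_sqrtr ?sqnorm_ge0 // mulVf //.
    by rewrite sqnorm_eq0.
  under eq_bigr do rewrite mxE mulrCA.
  by rewrite -mulr_sumr lz mulr0.
have Kne : K !=set0 by eexists; exact: scale_in v0N0 lv0.
have Kc : compact K.
  apply: bounded_closed_compact.
    exists 1; split; first by rewrite num_real.
    move=> A A1 r [r1 _]; apply: le_trans (ltW A1).
    apply: mx_norm_le => // i j.
    rewrite ord1 -(ler_pXn2r (n:=2)) ?nnegrE // expr1n real_normK ?num_real //.
    rewrite -r1 /csq (bigD1 j) //= lerDl; apply: sumr_ge0 => k _; exact: sqr_ge0.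
  apply: closedI.
    apply: (@closed_comp _ _ csq [set x | x = 1]); first by move=> x _; exact: csqC.
    exact: closed_eq.
  apply: (@closed_comp _ _ ccomb [set x | x = 0]); first by move=> x _; exact: ccombC.
  exact: closed_eq.
have [r rK rmin] := EVT_min_rV Kne Kc (continuous_subspaceT cqC).
move/set_mem: rK => [r1 r0].
exists r^T; split; rewrite -?sqT -?cT //.
move=> z lz; have [->|zN0] := eqVneq z 0.
  have /eqP-> : sqnorm (0 : 'cV[R]_n) == 0 by rewrite sqnorm_eq0.
  by rewrite mulr0 /qform mulmx0 mxE.
have := rmin _ (mem_set (scale_in _ zN0 lz)); rewrite !qT trmxK qformZ exprVn.
by rewrite sqr_sqrtr ?sqnorm_ge0 // ler_pdivlMl ?lt_def ?sqnorm_ge0 ?sqnorm_eq0 ?zN0 // mulrC.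
Qed.

Lemma quadratic_neg (R : realFieldType) (s q : R) :
  0 < s -> 0 <= q -> exists t, 2 * t * s + t ^+ 2 * q < 0.
Proof.
move=> s0 q0; have q1 : 0 < q + 1 by lra.
exists (- (s / (q + 1))).
have -> : 2 * - (s / (q + 1)) * s + (- (s / (q + 1))) ^+ 2 * q
    = s ^+ 2 / (q + 1) * (q / (q + 1) - 2) by field; lra.
rewrite nmulr_llt0 ?divr_gt0 ?exprn_gt0 // subr_lt0 ltr_pdivrMr //; lra.
Qed.

(** A zero of a nonnegative form is a minimum, so the derivative [2 M v] vanishes
    there; the direction [M v] itself detects it. *)
Lemma psd_qform0 (R : realType) (n : nat) (M : 'M[R]_n) (v : 'cV[R]_n) :
  M^T = M -> psd M -> qform M v = 0 -> M *m v = 0.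
Proof.
move=> Ms Mp qv0; pose u := M *m v.
have uv t : qform M (v + t *: u) = 2 * t * sqnorm u + t ^+ 2 * qform M u.
  have e1 : (u^T *m M *m v) 0 0 = sqnorm u.
    by rewrite -mulmxA !mxE; apply: eq_bigr => i _; rewrite !mxE expr2.
  have sym (a b : 'cV[R]_n) : (a^T *m M *m b) 0 0 = (b^T *m M *m a) 0 0.
    by rewrite -[a^T *m M *m b]trmxK [LHS]mxE !trmx_mul trmxK Ms mulmxA.
  have e2 : (v^T *m M *m u) 0 0 = sqnorm u by rewrite sym.
  have -> : qform M (v + t *: u) = qform M v + t * (v^T *m M *m u) 0 0
     + t * (u^T *m M *m v) 0 0 + t ^+ 2 * qform M u.
    have tr : (v + t *: u)^T = v^T + t *: u^T by rewrite linearD linearZ.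
    rewrite /qform tr !mulmxDl !mulmxDr -!scalemxAl -!scalemxAr.
    have mD (A B : 'M[R]_1) : (A + B) 0 0 = A 0 0 + B 0 0 by rewrite mxE.
    have mZ a (A : 'M[R]_1) : (a *: A) 0 0 = a * A 0 0 by rewrite mxE.
    rewrite !(mD, mZ); ring.
  by rewrite qv0 e1 e2; ring.
apply/eqP; rewrite -/u -sqnorm_eq0 eq_le sqnorm_ge0 andbT leNgt; apply/negP => u_gt0.
have qu : 0 <= qform M u by exact: Mp.
have [t tlt] := quadratic_neg u_gt0 qu.
by have := Mp (v + t *: u); rewrite -/(qform _ _) uv leNgt tlt.
Qed.

Lemma laplacian_mul (R : realType) (n : nat) (w : 'I_n -> 'I_n -> R) (v : 'cV[R]_n) i :
  (laplacian w *m v) i 0 = \sum_j w i j * (v i 0 - v j 0).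
Proof.
rewrite mxE (bigD1 i) //= mxE eqxx [RHS](bigD1 i) //= subrr mulr0 add0r mulr_suml.
rewrite -big_split /=; apply: eq_bigr => j ji.
by rewrite mxE eq_sym (negPf ji); ring.
Qed.

Lemma laplacian_qform (R : realType) (n : nat) (w : 'I_n -> 'I_n -> R) (v : 'cV[R]_n) :
  (forall i j, w i j = w j i) ->
  qform (laplacian w) v = 2^-1 * \sum_i \sum_j w i j * (v i 0 - v j 0) ^+ 2.
Proof.
move=> ws; apply: (mulfI (x := 2)); rewrite ?pnatr_eq0 //.
rewrite mulrA divff ?pnatr_eq0 // mul1r.
have e : qform (laplacian w) v = \sum_i \sum_j w i j * (v i 0 - v j 0) * v i 0.
  rewrite /qform -mulmxA mxE; apply: eq_bigr => i _.
  by rewrite laplacian_mul mxE mulrC mulr_suml.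
rewrite mulr_natl mulr2n {2}e exchange_big e -big_split /=; apply: eq_bigr => i _.
rewrite -big_split /=; apply: eq_bigr => j _; rewrite [w j i]ws; ring.
Qed.

Lemma laplacian_tr (R : realType) (n : nat) (w : 'I_n -> 'I_n -> R) :
  (forall i j, w i j = w j i) -> (laplacian w)^T = laplacian w.
Proof.
move=> ws; apply/matrixP => i j; rewrite !mxE eq_sym.
by case: eqVneq => [->//|_]; rewrite ws.
Qed.

(** A maximizer of the form on the unit sphere is an eigenvector, by [psd_qform0]
    applied to [c%:M - M], so the maximal value [c] is an eigenvalue. *)
Lemma qform_le_lambda_max (R : realType) (n : nat) (M : 'M[R]_n) (z : 'cV[R]_n) :
  M^T = M -> qform M z <= lambda_max M * sqnorm z.
Proof.
move=> Ms; have [->|zN0] := eqVneq z 0.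
  have /eqP-> : sqnorm (0 : 'cV[R]_n) == 0 by rewrite sqnorm_eq0.
  by rewrite mulr0 /qform mulmx0 mxE.
have [|v [v1 _ vmin]] := @qform_min_on_hyperplane R n (- M) 0.
  by exists z => //; rewrite big1 // => i _; rewrite mxE mul0r.
pose c := qform M v.
have cmax y : qform M y <= c * sqnorm y.
  have := vmin y; rewrite !qformN mulNr lerN2; apply.
  by rewrite big1 // => i _; rewrite mxE mul0r.
have Nv : (c%:M - M) *m v = 0.
  apply: psd_qform0; first by rewrite linearB /= tr_scalar_mx Ms.
    by move=> y; rewrite -/(qform _ _) qformB qform_scalar subr_ge0.
  by rewrite qformB qform_scalar v1 mulr1 subrr.
have vc : eigenvalue M c.
  apply/eigenvalueP; exists v^T; last first.
    by apply: contra_eq_neq v1 => /(canRL (@trmxK _ _ _)) ->; rewrite trmx0;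
       move: (sqnorm_eq0 (0 : 'cV[R]_n)); rewrite eqxx => /eqP ->; rewrite eq_sym oner_eq0.
  apply: trmx_inj; rewrite trmx_mul trmxK Ms linearZ /= trmxK.
  by move/eqP: Nv; rewrite mulmxBl mul_scalar_mx subr_eq0 => /eqP <-.
apply: le_trans (cmax z) _; rewrite ler_wpM2r ?sqnorm_ge0 //.
apply: ub_le_sup => //; exists c => a /eigenvalueP[y My yN0].
have yTN0 : y^T != 0 by rewrite -[0]trmx0 (inj_eq (@trmx_inj _ _ _)).
have := cmax y^T; rewrite /qform trmxK My -scalemxAl mxE.
rewrite [X in a * X](_ : _ = sqnorm y^T); last first.
  by rewrite mxE; apply: eq_bigr => i _; rewrite mxE expr2.
by rewrite ler_pM2r // lt_def sqnorm_eq0 yTN0 sqnorm_ge0.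
Qed.

(** Geometric multiplicity is at most algebraic multiplicity. After the rank
    factorization [M = L * pid * U], the matrix ['X - M] becomes, up to invertible
    factors, one whose last [n - rank] rows are divisible by ['X]. *)
Lemma mup_char_poly_ge (R : realType) (n : nat) (M : 'M[R]_n) :
  (n - \rank M <= mup 0 (char_poly M))%N.
Proof.
rewrite mup_geq ?monic_neq0 ?char_poly_monic // subr0.
set r := \rank M; pose L := col_ebase M; pose U := row_ebase M.
have LU : L *m pid_mx r *m U = M by exact: mulmx_ebase.
have Lu : L \in unitmx by exact: col_ebase_unit.
have Uu : U \in unitmx by exact: row_ebase_unit.
pose N : 'M[R]_n := invmx L *m invmx U.
have detS (c : 'M[R]_n) : \det (map_mx (polyC : R -> {poly R}) c) = (\det c)%:P.
  exact: det_map_mx.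
have -> : char_poly M =
    (\det L)%:P * \det ('X *: map_mx polyC N - map_mx polyC (pid_mx r : 'M[R]_n)) * (\det U)%:P.
  rewrite -!detS -!det_mulmx /char_poly /char_poly_mx; congr (\det _).
  rewrite mulmxBr mulmxBl -scalemxAr -scalemxAl -!map_mxM LU; congr (_ - _).
  by rewrite mulmxA mulmxV // mul1mx mulVmx // map_mx1 scalemx1.
apply: dvdp_mulr; apply: dvdp_mull.
pose d : 'rV[{poly R}]_n := \row_i (if (i < r)%N then 1 else 'X).
pose B : 'M[{poly R}]_n := \matrix_(i, j) if (i < r)%N then 'X * (N i j)%:P - ((i == j :> nat)%:R)%:P
                                        else (N i j)%:P.
have -> : 'X *: map_mx polyC N - map_mx polyC (pid_mx r : 'M[R]_n) = diag_mx d *m B.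
  apply/matrixP => i j; rewrite mul_diag_mx !mxE.
  case: ltnP => ir; first by rewrite andbT mul1r.
  by rewrite andbF polyC0 subr0.
rewrite det_mulmx det_diag; apply: dvdp_mulr.
under eq_bigr do rewrite mxE -if_neg -leqNgt.
rewrite -big_mkcond /= prodr_const.
rewrite dvdp_exp2l // cardE size_filter.
suff -> : count (fun i : 'I_n => (r <= i)%N) (Finite.enum 'I_n) = (n - r)%N by [].
rewrite -enumT -(count_map val (fun i => r <= i)%N) val_enum_ord.
have rn : (r <= n)%N by exact: rank_leq_row.
rewrite -{1}(subnKC rn) iotaD count_cat add0n.
rewrite (eq_in_count (a2 := pred0)) ?count_pred0; last first.
  by move=> i; rewrite mem_iota add0n leq0n /= ltnNge => /negPf.
rewrite (eq_in_count (a2 := predT)) ?count_predT ?size_iota //.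
by move=> i; rewrite mem_iota => /andP[].
Qed.

(** If the minimum over unit vectors orthogonal to the all-ones vector were 0, the
    minimizer and the all-ones vector would span a kernel of dimension 2, against
    the simplicity of the eigenvalue. *)
Lemma laplacian_coercive (R : realType) (n : nat) (w : 'I_n -> 'I_n -> R) :
  (forall i j, w i j = w j i) -> psd (laplacian w) ->
  simple_zero_eigenvalue (laplacian w) ->
  exists2 c : R, 0 < c & forall z : 'cV[R]_n, \sum_i z i 0 = 0 ->
    c * sqnorm z <= qform (laplacian w) z.
Proof.
move=> ws Lp Ls; set M := laplacian w.
have Ms : M^T = M by exact: laplacian_tr.
pose one : 'cV[R]_n := const_mx 1.
have dot1 (z : 'cV[R]_n) : \sum_i one i 0 * z i 0 = \sum_i z i 0.
  by apply: eq_bigr => i _; rewrite mxE mul1r.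
have [|none] := pselect (exists2 v : 'cV[R]_n, v != 0 & \sum_i one i 0 * v i 0 = 0); last first.
  exists 1 => // z z0; have [->|zN0] := eqVneq z 0.
    have /eqP-> : sqnorm (0 : 'cV[R]_n) == 0 by rewrite sqnorm_eq0.
    by rewrite mulr0 /qform mulmx0 mxE.
  by case: none; exists z => //; rewrite dot1.
move/(qform_min_on_hyperplane M) => [v [v1 v0 vmin]].
exists (qform M v); last by move=> z z0; apply: vmin; rewrite dot1.
rewrite lt_def Lp andbT; apply/eqP => qv0.
have Mv : M *m v = 0 by exact: psd_qform0.
have M1 : M *m one = 0.
  by apply/colP => i; rewrite laplacian_mul big1 => [|j _]; rewrite !mxE // subrr mulr0.
have nN0 : (n%:R : R) != 0.
  rewrite pnatr_eq0; apply/eqP => n0; move: v1; rewrite /sqnorm big1 => [/eqP|i].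
    by rewrite eq_sym oner_eq0.
  by have := ltn_ord i; rewrite {2}n0.
have rk : (n - \rank M <= 1)%N by rewrite -[X in (_ <= X)%N]Ls; exact: mup_char_poly_ge.
have sub (y : 'cV[R]_n) : M *m y = 0 -> (y^T <= kermx M)%MS.
  by move=> My; apply/sub_kermxP; apply: trmx_inj; rewrite trmx_mul trmxK Ms My trmx0.
have one1 : \rank one^T = 1%N.
  rewrite rank_rV; case: eqP => // o0.
  have oi i : one i 0 = 0 by rewrite -[one]trmxK o0 !mxE.
  move: nN0; apply: contraNeq => _; rewrite -[X in X%:R](card_ord n) -sumr_const.
  by apply/eqP/big1 => i _; have := oi i; rewrite mxE.
have kle : (kermx M <= one^T)%MS.
  have [_] := mxrank_leqif_sup (sub _ M1); rewrite one1 mxrank_ker => <-.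
  rewrite eqn_leq rk andbT; have := mxrankS (sub _ M1).
  by rewrite one1 mxrank_ker.
have /sub_rVP[a va] := submx_trans (sub _ Mv) kle.
have ve i : v i 0 = a by have /rowP/(_ i) := va; rewrite !mxE mulr1.
move: v0; rewrite dot1; under eq_bigr do rewrite ve.
rewrite sumr_const card_ord -mulr_natr => /eqP; rewrite mulf_eq0 (negPf nN0) orbF => /eqP a0.
move: v1; rewrite /sqnorm big1 => [/eqP|i _]; first by rewrite eq_sym oner_eq0.
by rewrite ve a0 expr0n.
Qed.

(** * Powers of complex numbers near 1 in the unit disc *)

Definition cnormsq {R : realType} (z : R[i]) : R :=
  complex.Re z ^+ 2 + complex.Im z ^+ 2.

Lemma cnormsqM (R : realType) (z w : R[i]) : cnormsq (z * w) = cnormsq z * cnormsq w.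
Proof. by case: z => a b; case: w => c d; rewrite /cnormsq /=; ring. Qed.

Lemma cnormsq_ge0 (R : realType) (z : R[i]) : 0 <= cnormsq z.
Proof. by rewrite addr_ge0 ?sqr_ge0. Qed.

Lemma cnormsqX (R : realType) (z : R[i]) m : cnormsq (z ^+ m) = cnormsq z ^+ m.
Proof.
elim: m => [|m IH]; first by rewrite !expr0 /cnormsq /= expr1n expr0n addr0.
by rewrite !exprS cnormsqM IH.
Qed.

Lemma Re_le_cnormsq (R : realType) (z : R[i]) : cnormsq z <= 1 -> `|complex.Re z| <= 1.
Proof.
move=> z1; rewrite -(ler_pXn2r (n:=2)) ?nnegrE // expr1n real_normK ?num_real //.
by apply: le_trans z1; rewrite lerDl sqr_ge0.
Qed.

Lemma ReD (R : realType) (z w : R[i]) : complex.Re (z + w) = complex.Re z + complex.Re w.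
Proof. by case: z; case: w. Qed.

Lemma Re_sum (R : realType) (I : finType) (F : I -> R[i]) :
  complex.Re (\sum_i F i) = \sum_i complex.Re (F i).
Proof. by apply: (big_morph _ (@ReD R)). Qed.

Lemma cis_expr (R : realType) (al : R) m :
  (cos al +i* sin al)%C ^+ m = (cos (m%:R * al) +i* sin (m%:R * al))%C.
Proof.
elim: m => [|m IH]; first by rewrite expr0 mul0r cos0 sin0.
rewrite exprSr IH -natr1 mulrDl mul1r cosD sinD.
by apply/eqP; rewrite eq_complex /=; apply/andP; split; apply/eqP; ring.
Qed.

Lemma atan_le_id (R : realType) (x : R) : `|atan x| <= `|x|.
Proof.
have pos (y : R) : 0 < y -> 0 <= atan y <= y.
  move=> y0; have dat (z : R) : z \in `]0, y[ -> is_derive z 1 atan (1 + z ^+ 2)^-1.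
    by move=> _; exact: is_derive1_atan.
  have cat : {within `[0, y], continuous (@atan R)}.
    by apply: continuous_subspaceT => z; exact: continuous_atan.
  have [z _] := MVT y0 dat cat.
  rewrite atan0 !subr0 => ->; have z1 : 1 <= 1 + z ^+ 2 by rewrite lerDl sqr_ge0.
  rewrite mulr_ge0 ?(ltW y0) ?invr_ge0 ?(le_trans ler01) //=.
  by rewrite ler_piMl ?(ltW y0) // invf_le1 // (lt_le_trans ltr01).
have [x0|x0|->] := ltgtP x 0; last by rewrite atan0.
  have := pos (- x); rewrite oppr_gt0 => /(_ x0) /andP[].
  by rewrite atanN => h1 h2; rewrite -normrN (ger0_norm h1) ltr0_norm.
by have /andP[h1 h2] := pos _ x0; rewrite !ger0_norm // ltW.
Qed.

(** The discrete counterpart of bounding [exp(- s tau)] for [|s| <= kappa]: if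
    [|1 - w| < kappa * delta] then [w] has modulus at least
    [exp(- kappa' * delta)] and argument at most [kappa' * delta], and the [m]-th
    power multiplies the exponent and the argument by [m <= tau / delta]. Passing from
    [kappa] to [kappa'] absorbs the quadratic error in [delta]. *)
Lemma expr_near_one (R : realType) (w : R[i]) (kappa kappa' delta tau : R) (m : nat) :
  cnormsq w <= 1 -> cnormsq (1 - w) < (kappa * delta) ^+ 2 ->
  0 < delta -> 0 < kappa -> kappa < kappa' -> kappa * kappa' * delta <= kappa' - kappa ->
  m%:R * delta <= tau ->
  exists rho beta, [/\ complex.Re (w ^+ m) = rho * cos beta,
    expR (- (kappa' * tau)) <= rho <= 1 & `|beta| <= kappa' * tau].
Proof.
case: w => x y w1 w2 d0 k0 kk' small mtau.
have k'0 : 0 < kappa' by exact: lt_trans kk'.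
have kd0 : 0 < kappa * delta by rewrite mulr_gt0.
move: w1 w2; rewrite /cnormsq /= sub0r sqrrN => w1 w2.
have kd1 : kappa * delta < 1.
  by rewrite -(ltr_pM2r k'0) mul1r mulrAC; apply: le_lt_trans small _; lra.
have x1 : 1 - kappa * delta <= x.
  suff : `|1 - x| <= kappa * delta by rewrite ler_norml; lra.
  rewrite -(ler_pXn2r (n:=2)) ?nnegrE ?(ltW kd0) // real_normK ?num_real //.
  by apply: le_trans (ltW w2); rewrite lerDl sqr_ge0.
have y1 : `|y| <= kappa * delta.
  rewrite -(ler_pXn2r (n:=2)) ?nnegrE ?(ltW kd0) // real_normK ?num_real //.
  by apply: le_trans (ltW w2); rewrite lerDr sqr_ge0.
have x0 : 0 < x by lra.
pose t := y / x; pose s := Num.sqrt (1 + t ^+ 2).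
have s0 : 0 < s by rewrite sqrtr_gt0 ltr_wpDr ?sqr_ge0.
have s2 : s ^+ 2 = 1 + t ^+ 2 by rewrite sqr_sqrtr // addr_ge0 ?sqr_ge0.
pose al := atan t.
have cosal : cos al = s^-1 by rewrite cos_atan.
have sinal : sin al = t * s^-1.
  have tal : sin al / cos al = t by exact: atanK.
  have cN0 : cos al != 0 by rewrite cosal invr_neq0 // lt0r_neq0.
  by rewrite -cosal; move: tal => <-; rewrite divfK.
pose r := x * s.
have r0 : 0 <= r by rewrite mulr_ge0 // ltW.
have wE : (x +i* y)%C = r%:C%C * (cos al +i* sin al)%C.
  apply/eqP; rewrite eq_complex /= cosal sinal /r; apply/andP; split; apply/eqP.
    by rewrite mul0r subr0 mulfK // lt0r_neq0.
  rewrite mul0r addr0 mulrCA mulfK ?lt0r_neq0 // /t divfK // lt0r_neq0 //.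
have r1 : r <= 1.
  rewrite -(ler_pXn2r (n:=2)) ?nnegrE // expr1n; apply: le_trans w1.
  rewrite /r exprMn s2 mulrDr mulr1 /t expr_div_n mulrCA divff ?mulr1 //.
  by rewrite expf_neq0 // lt0r_neq0.
have rx : 1 - kappa * delta <= r.
  apply: le_trans x1 _; rewrite ler_peMr ?(ltW x0) //.
  by rewrite -(ler_pXn2r (n:=2)) ?nnegrE ?(ltW s0) // expr1n s2 lerDl sqr_ge0.
exists (r ^+ m), (m%:R * al); split.
- by rewrite wE exprMn cis_expr -rmorphXn /= mul0r subr0.
- rewrite exprn_ile1 // andbT.
  have base : expR (- (kappa' * delta)) <= r.
    apply: le_trans rx; rewrite expRN -[leRHS]invrK lef_pV2 ?posrE ?expR_gt0 //; last first.
      by rewrite invr_gt0; lra.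
    apply: le_trans (expR_ge1Dx _); rewrite invf_ple ?posrE; [|lra|]; last first.
      by rewrite addr_gt0 // mulr_gt0.
    rewrite -[leLHS]mul1r ler_pdivrMr; last by rewrite addr_gt0 // mulr_gt0.
    have -> : (1 - kappa * delta) * (1 + kappa' * delta)
        = 1 + (kappa' - kappa - kappa * kappa' * delta) * delta by ring.
    by rewrite lerDl mulr_ge0 ?(ltW d0) // subr_ge0.
  apply: le_trans (_ : expR (- (kappa' * delta)) ^+ m <= _); last first.
    by rewrite lerXn2r ?nnegrE // expR_ge0.
  rewrite -expRM_natl ler_expR mulrN lerN2 mulrCA ler_wpM2l // ltW //.
- rewrite normrM ger0_norm // (le_trans (_ : _ <= m%:R * (kappa' * delta))) //; last first.
    by rewrite mulrCA ler_wpM2l // ltW.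
  rewrite ler_wpM2l // (le_trans (atan_le_id _)) // /t normrM normfV (gtr0_norm x0).
  rewrite ler_pdivrMr //; apply: (le_trans y1); apply: (@le_trans _ _ (kappa' * delta * (1 - kappa * delta))).
    have -> : kappa' * delta * (1 - kappa * delta)
      = kappa * delta + (kappa' - kappa - kappa * kappa' * delta) * delta by ring.
    by rewrite lerDl mulr_ge0 ?(ltW d0) // subr_ge0.
  by rewrite ler_wpM2l // mulr_ge0 ?ltW.
Qed.

(** * Coercivity of the discretized symbol *)

Lemma le_cos (R : realType) (x y : R) : 0 <= y -> y <= x -> x <= pi -> cos x <= cos y.
Proof.
move=> y0 yx xpi; rewrite leNgt ltr_cos ?in_itv /= ?y0 ?xpi ?(le_trans y0 yx) ?(le_trans yx xpi) //.
by rewrite -leNgt.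
Qed.

(** The edge values of [L_tau] bound [a_ij Re exp(- s tau_ij)] from below for
    [|s| <= lambda_bar], as [exp(- x) cos x] and [cos x] decrease on the relevant
    ranges; by continuity the bound persists up to [eta] slightly beyond
    [lambda_bar]. *)
Lemma delay_weight_robust (R : realType) (n : nat) (G : delay_graph R n) (eta : R) :
  0 < eta -> exists2 kappa, lambda_bar G < kappa &
    forall i j rho beta, expR (- (kappa * delay G i j)) <= rho <= 1 ->
      `|beta| <= kappa * delay G i j ->
      delay_weight G i j <= adj G i j * (rho * cos beta) + eta * `|adj G i j|.
Proof.
move=> eta0; pose lam := lambda_bar G.
pose P (tau k : R) := [/\ lam < k,
   tau * lam < pi / 2 -> k * tau < pi / 2 /\
      expR (- (tau * lam)) * cos (tau * lam) - eta < expR (- (k * tau)) * cos (k * tau) &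
   tau * lam < pi -> k * tau < pi /\ cos (tau * lam) - eta < cos (k * tau)].
have nearP tau : \forall k \near lam^'+, P tau k.
  have cid' : (k * tau) @[k --> lam] --> tau * lam.
    by rewrite [tau * _]mulrC; apply: cvgM; [exact: cvg_id | exact: cvg_cst].
  have ccos : cos (k * tau) @[k --> lam] --> cos (tau * lam).
    by apply: cvg_comp cid' _; exact: continuous_cos.
  have cexp : expR (- (k * tau)) @[k --> lam] --> expR (- (tau * lam)).
    apply: (@cvg_comp _ _ _ (fun k => - (k * tau)) expR); first exact: cvgN cid'.
    exact: continuous_expR.
  have cprod : expR (- (k * tau)) * cos (k * tau) @[k --> lam] -->
      expR (- (tau * lam)) * cos (tau * lam) by exact: cvgM.
  have lt_near (f : R -> R) (l M : R) : f @ lam --> l -> l < M -> \forall k \near lam^'+, f k < M.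
    by move=> fl lM; apply: (@cvg_within _ (nbhs lam)); exact: (cvgr_lt l fl).
  have gt_near (f : R -> R) (l M : R) : f @ lam --> l -> M < l -> \forall k \near lam^'+, M < f k.
    by move=> fl lM; apply: (@cvg_within _ (nbhs lam)); exact: (cvgr_gt l fl).
  have n1 : \forall k \near lam^'+, tau * lam < pi / 2 -> k * tau < pi / 2.
    have [h|h] := ltP (tau * lam) (pi / 2); last by near=> k.
    by near=> k => _; near: k; exact: (lt_near (fun k => k * tau) _ _ cid').
  have n2 : \forall k \near lam^'+,
      expR (- (tau * lam)) * cos (tau * lam) - eta < expR (- (k * tau)) * cos (k * tau).
    by apply: (gt_near (fun k => expR (- (k * tau)) * cos (k * tau)) _ _ cprod); rewrite ltrBlDr ltrDl.
  have n3 : \forall k \near lam^'+, tau * lam < pi -> k * tau < pi.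
    have [h|h] := ltP (tau * lam) pi; last by near=> k.
    by near=> k => _; near: k; exact: (lt_near (fun k => k * tau) _ _ cid').
  have n4 : \forall k \near lam^'+, cos (tau * lam) - eta < cos (k * tau).
    by apply: (gt_near (fun k => cos (k * tau)) _ _ ccos); rewrite ltrBlDr ltrDl.
  near=> k; split.
  - by near: k; exact: nbhs_right_gt.
  - by move=> h; split; [move: h; near: k | near: k].
  - by move=> h; split; [move: h; near: k | near: k].
have [k [lamk kP]] : exists k, lam < k /\ forall i j, P (delay G i j) k.
  have : \forall k \near lam^'+, lam < k /\ forall i j, P (delay G i j) k.
    apply: filterI; first exact: nbhs_right_gt.
    have Pij i : \forall k \near lam^'+, forall j, P (delay G i j) k.
      by apply: (@filter_forall _ _ (fun j k => P (delay G i j) k)) => j; exact: nearP.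
    exact: (@filter_forall _ _ (fun i k => forall j, P (delay G i j) k) _ _ Pij).
  by move=> /filter_ex[k kP]; exists k.
exists k => // i j rho beta /andP[rhol rho1] betak.
have rho0 : 0 <= rho by apply: le_trans rhol; exact: expR_ge0.
have [_ h1 h2] := kP i j; rewrite /delay_weight.
set a := adj G i j; set tau := delay G i j in h1 h2 rhol betak *.
have cabs : `|rho * cos beta| <= 1.
  by rewrite normrM (ger0_norm rho0) -[leRHS]mulr1 ler_pM // cos_max.
have [|E] := boolP (edge G i j); last first.
  by rewrite /= /a adj_nonedge // normr0 mul0r mulr0 addr0.
move=> E; rewrite /=; case: (ltrP a 0) => a0.
  have := mulr_ge0 (ltW eta0) (normr_ge0 a); move: cabs; rewrite ler_norml => /andP[_ c1] ea.
  by rewrite ler_wpDr // ler_nMr.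
rewrite (ger0_norm a0) -/lam [eta * a]mulrC -mulrDr.
suff : (if tau == 0 then 1 else if tau * lam < pi / 2 then expR (- (tau * lam)) * cos (tau * lam)
        else if tau * lam < pi then cos (tau * lam) else -1) <= rho * cos beta + eta.
  move=> h; apply: le_trans (ler_wpM2l a0 h).
  rewrite !(fun_if ( *%R a)) mulr1 mulrN1 mulrA; do 3?case: ifP => _ //.
case: eqP => [tau0|_].
  move: rhol betak; rewrite tau0 mulr0 oppr0 expR0 normr_le0 => rhol /eqP ->.
  by rewrite cos0 mulr1; lra.
have bpi : cos beta = cos `|beta| by rewrite cos_norm.
case: ltP => t1.
  have [k1 k2] := h1 t1.
  have c0 : 0 <= cos (k * tau).
    apply: cos_ge0_pihalf; rewrite (ltW k1) andbT (le_trans _ (le_trans (normr_ge0 _) betak)) //.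
    by rewrite oppr_le0 divr_ge0 // pi_ge0.
  have c1 : cos (k * tau) <= cos beta.
    by rewrite bpi le_cos // (le_trans (ltW k1)) // ler_pdivrMr // ler_peMr ?pi_ge0 // ler1n.
  have := ler_pM (expR_ge0 _) c0 rhol c1; lra.
case: ltP => t2.
  have [k1 k2] := h2 t2.
  have c0 : cos (tau * lam) <= 0.
    by rewrite -cos_pihalf le_cos // ?(ltW t2) // divr_ge0 // pi_ge0.
  have c1 : cos (k * tau) <= cos beta by rewrite bpi le_cos // ltW.
  have [cb|cb] := leP 0 (cos beta); first by have := mulr_ge0 rho0 cb; lra.
  suff : cos beta <= rho * cos beta by lra.
  by rewrite ler_niMl // ltW.
by move: cabs; rewrite ler_norml => /andP[]; lra.
Unshelve. all: by end_near. Qed.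

(** The transfer matrix of [scheme]: applied to the generating function of a
    sequence at [w], it gives the generating function of its defect. *)
Definition symbol {R : realType} {n : nat} (a : 'I_n -> 'I_n -> R)
    (m : 'I_n -> 'I_n -> nat) (delta : R) (w : R[i]) (v : 'I_n -> R[i]) (i : 'I_n) : R[i] :=
  (delta^-1)%:C%C * (1 - w) * v i +
  \sum_j (a i j)%:C%C * w ^+ m i j * (v i - v j).

Lemma conjc_mul_cnormsq (R : realType) (z : R[i]) : (conjc z * z = (cnormsq z)%:C)%C.
Proof. by case: z => x y; apply/eqP; rewrite eq_complex /= /cnormsq /=; apply/andP; split; apply/eqP; ring. Qed.

Lemma conjcB (R : realType) (z w : R[i]) : (conjc (z - w) = conjc z - conjc w)%C.
Proof. by rewrite rmorphB. Qed.

Lemma Re_mul_real (R : realType) (z : R[i]) (x : R) :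
  complex.Re (z * x%:C%C) = complex.Re z * x.
Proof. by case: z => a b /=; rewrite mulr0 subr0. Qed.

(** Symmetry of the weights turns the coupling term into a sum over edges of
    squared differences, as for a real Laplacian. *)
Lemma symbol_form (R : realType) (n : nat) (a : 'I_n -> 'I_n -> R)
    (m : 'I_n -> 'I_n -> nat) (delta : R) (u w : R[i]) (v : 'I_n -> R[i]) :
  (forall i j, a i j = a j i) -> (forall i j, m i j = m j i) ->
  complex.Re (u * \sum_i conjc (v i) * symbol a m delta w v i) =
  delta^-1 * complex.Re (u * (1 - w)) * \sum_i cnormsq (v i) +
  2^-1 * \sum_i \sum_j a i j * complex.Re (u * w ^+ m i j) * cnormsq (v i - v j).
Proof.
move=> sa sm.
pose F i j : R[i] := (a i j)%:C%C * w ^+ m i j * (v i - v j).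
have e : \sum_i conjc (v i) * symbol a m delta w v i =
    (delta^-1)%:C%C * (1 - w) * \sum_i (cnormsq (v i))%:C%C + \sum_i \sum_j conjc (v i) * F i j.
  rewrite mulr_sumr -big_split /=; apply: eq_bigr => i _.
  rewrite /symbol mulrDr mulr_sumr; congr (_ + _).
  by rewrite -conjc_mul_cnormsq; ring.
have e2 : \sum_i \sum_j conjc (v i) * F i j =
    (2^-1)%:C%C * \sum_i \sum_j (a i j)%:C%C * w ^+ m i j * (cnormsq (v i - v j))%:C%C.
  have two : (2^-1)%:C%C * 2%:R = 1 :> R[i].
    by rewrite -(rmorph_nat (real_complex R)) -rmorphM mulVf ?rmorph1 // pnatr_eq0.
  rewrite -[LHS]mul1r -two -mulrA; congr (_ * _).
  rewrite mulr_natl mulr2n {2}exchange_big -big_split /=; apply: eq_bigr => i _.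
  rewrite -big_split /=; apply: eq_bigr => j _.
  by rewrite /F [a j i]sa [m j i]sm -conjc_mul_cnormsq conjcB; ring.
rewrite e e2 mulrDr ReD; congr (_ + _).
  rewrite mulrA -rmorph_sum /= Re_mul_real; congr (_ * _).
  by case: u => x y; case: (1 - w) => z t /=; ring.
rewrite mulrCA mulrC Re_mul_real mulrC mulr_sumr Re_sum; congr (_ * _).
apply: eq_bigr => i _; rewrite mulr_sumr Re_sum; apply: eq_bigr => j _.
rewrite mulrA Re_mul_real; congr (_ * _).
by rewrite mulrCA mulrC Re_mul_real mulrC.
Qed.

(** Cauchy-Schwarz in the form [2 c |v| |q| <= c^2 |v|^2 + |q|^2]: a lower bound on
    the real part of a rotated form bounds the operator from below. *)
Lemma multiplier_bound (R : realType) (n : nat) (c : R) (u : R[i]) (v q : 'I_n -> R[i]) :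
  0 < c -> cnormsq u <= 1 ->
  c * \sum_i cnormsq (v i) <= complex.Re (u * \sum_i conjc (v i) * q i) ->
  c ^+ 2 * \sum_i cnormsq (v i) <= \sum_i cnormsq (q i).
Proof.
move=> c0 u1 h.
have pointwise i : 2 * c * complex.Re (u * (conjc (v i) * q i)) <=
    c ^+ 2 * cnormsq (v i) + cnormsq (q i).
  rewrite mulrA; set s := u * conjc (v i).
  have sv : cnormsq s <= cnormsq (v i).
    have -> : cnormsq s = cnormsq u * cnormsq (v i).
      by rewrite cnormsqM; congr (_ * _); case: (v i) => x y; rewrite /cnormsq /= sqrrN.
    by rewrite ler_piMl // cnormsq_ge0.
  apply: le_trans (_ : c ^+ 2 * cnormsq s + cnormsq (q i) <= _); last first.
    by rewrite lerD2r ler_wpM2l // sqr_ge0.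
  case: s (q i) {sv} => s1 s2 [q1 q2]; rewrite /cnormsq /= -subr_ge0.
  have -> : c ^+ 2 * (s1 ^+ 2 + s2 ^+ 2) + (q1 ^+ 2 + q2 ^+ 2) - 2 * c * (s1 * q1 - s2 * q2)
    = (c * s1 - q1) ^+ 2 + (c * s2 + q2) ^+ 2 by ring.
  by rewrite addr_ge0 ?sqr_ge0.
have : 2 * c * (c * \sum_i cnormsq (v i)) <= c ^+ 2 * \sum_i cnormsq (v i) + \sum_i cnormsq (q i).
  apply: le_trans (ler_wpM2l _ h) _; first by rewrite mulr_ge0 ?ltW.
  rewrite mulr_sumr Re_sum !mulr_sumr -big_split /=; exact: ler_sum.
set S := \sum_i cnormsq (v i); set T := \sum_i cnormsq (q i); lra.
Qed.

(** Real symmetric forms split over real and imaginary parts, which transfers the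
    real spectral bounds to complex vectors. *)
Lemma sum_cnormsq_qform (R : realType) (n : nat) (W : 'I_n -> 'I_n -> R) (v : 'I_n -> R[i]) :
  (forall i j, W i j = W j i) ->
  2^-1 * \sum_i \sum_j W i j * cnormsq (v i - v j) =
  qform (laplacian W) (\col_i complex.Re (v i)) + qform (laplacian W) (\col_i complex.Im (v i)).
Proof.
move=> sW; rewrite !laplacian_qform // -mulrDr -big_split /=; congr (_ * _).
apply: eq_bigr => i _; rewrite -big_split /=; apply: eq_bigr => j _.
rewrite !mxE -mulrDr; congr (_ * _).
by case: (v i) => x y; case: (v j) => x' y'; rewrite /cnormsq.
Qed.

Lemma sum_cnormsq (R : realType) (n : nat) (v : 'I_n -> R[i]) :
  \sum_i cnormsq (v i) = sqnorm (\col_i complex.Re (v i)) + sqnorm (\col_i complex.Im (v i)).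
Proof.
by rewrite /sqnorm -big_split /=; apply: eq_bigr => i _; rewrite !mxE.
Qed.

Lemma delay_weight_sym (R : realType) (n : nat) (G : delay_graph R n) i j :
  delay_weight G i j = delay_weight G j i.
Proof. by rewrite /delay_weight edge_sym adj_sym delay_sym. Qed.

Lemma lambda_bar_ge0 (R : realType) (n : nat) (G : delay_graph R n.+1) : 0 <= lambda_bar G.
Proof.
have s : (L0_abs G)^T = L0_abs G by apply: laplacian_tr => i j; rewrite adj_sym.
have := qform_le_lambda_max (const_mx 1) s; rewrite laplacian_qform => [|i j]; last by rewrite adj_sym.
rewrite big1 => [|i _]; last by rewrite big1 // => j _; rewrite !mxE subrr expr0n mulr0.
rewrite mulr0 pmulr_lge0 // /sqnorm.
under eq_bigr do rewrite mxE expr1n.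
by rewrite sumr_const card_ord ltr0n.
Qed.

(** With [kappa] slightly above [lambda_bar]: if [|1 - w| >= kappa * delta],
    rotating by the argument of [1 - w] makes the first term at least
    [kappa |v|^2], and the coupling costs at most [lambda_bar |v|^2]; otherwise
    the real part of the form dominates that of [L_tau] up to a small error. The
    constant does not depend on [delta], which is essential to absorb the sampling
    errors later. *)
Lemma symbol_bound (R : realType) (n : nat) (G : delay_graph R n) :
  psd (L_tau G) -> simple_zero_eigenvalue (L_tau G) ->
  exists c delta0 : R, [/\ 0 < c, 0 < delta0 &
    forall delta m w (v : 'I_n -> R[i]), 0 < delta -> delta <= delta0 ->
    (forall i j, (m i j)%:R * delta <= delay G i j) -> (forall i j, m i j = m j i) ->
    cnormsq w <= 1 -> \sum_i v i = 0 ->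
    c ^+ 2 * \sum_i cnormsq (v i) <= \sum_i cnormsq (symbol (adj G) m delta w v i)].
Proof.
case: n G => [|n] G Lp Ls.
  by exists 1, 1; split=> // *; rewrite !big_ord0 mulr0.
have [c1 c1_gt0 coer] := laplacian_coercive (@delay_weight_sym _ _ G) Lp Ls.
have sabs i j : `|adj G i j| = `|adj G j i| by rewrite adj_sym.
have lam_max z := qform_le_lambda_max z (laplacian_tr sabs).
pose lam := lambda_bar G.
have lam0 : 0 <= lam by exact: lambda_bar_ge0.
(* The error [eta * lambda_bar |v|^2] must stay below half of the coercivity. *)
pose eta := c1 / (2 * (lam + 1)).
have eta0 : 0 < eta by rewrite divr_gt0 // mulr_gt0 // ltr_wpDl.
have [kappa' lamk' robust] := delay_weight_robust G eta0.
pose kappa := (lam + kappa') / 2.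
have lamk : lam < kappa by rewrite /kappa -/lam in lamk' *; lra.
have kk' : kappa < kappa' by rewrite /kappa -/lam in lamk' *; lra.
have k0 : 0 < kappa by exact: le_lt_trans lamk.
have k'0 : 0 < kappa' by exact: lt_trans kk'.
pose c := Num.min (kappa - lam) (c1 / 2).
have c0 : 0 < c by rewrite lt_min subr_gt0 lamk divr_gt0.
have [cA cB] : c <= kappa - lam /\ c <= c1 / 2 by rewrite !ge_min !lexx orbT.
exists c, ((kappa' - kappa) / (kappa * kappa')); split => //.
  by rewrite divr_gt0 ?subr_gt0 // mulr_gt0.
move=> delta m w v d0 dd0 mtau msym w1 v0.
have small : kappa * kappa' * delta <= kappa' - kappa.
  by rewrite mulrC -ler_pdivlMr // mulr_gt0.
set S := \sum_i cnormsq (v i).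
have S0 : 0 <= S by apply: sumr_ge0 => i _; exact: cnormsq_ge0.
have absS : 2^-1 * \sum_i \sum_j `|adj G i j| * cnormsq (v i - v j) <= lam * S.
  by rewrite sum_cnormsq_qform // /S sum_cnormsq mulrDr lerD.
have tauS : c1 * S <= 2^-1 * \sum_i \sum_j delay_weight G i j * cnormsq (v i - v j).
  rewrite sum_cnormsq_qform; last exact: delay_weight_sym.
  rewrite /S sum_cnormsq mulrDr lerD // coer //.
    by under eq_bigr do rewrite mxE; rewrite -Re_sum v0.
  have ImD : {morph @complex.Im R : x y / x + y} by move=> [x y] [x' y'].
  under eq_bigr do rewrite mxE.
  by rewrite -(big_morph _ ImD (erefl : complex.Im 0 = 0)) v0.
have half0 : 0 <= 2^-1 :> R by rewrite invr_ge0.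
have [far|near] := leP ((kappa * delta) ^+ 2) (cnormsq (1 - w)).
  pose s := Num.sqrt (cnormsq (1 - w)).
  have s2 : s ^+ 2 = cnormsq (1 - w) by rewrite sqr_sqrtr // cnormsq_ge0.
  have ks : kappa * delta <= s.
    by rewrite -(ler_pXn2r (n:=2)) ?nnegrE ?sqrtr_ge0 ?s2 // mulr_ge0 // ltW.
  have s0 : 0 < s by apply: lt_le_trans ks; rewrite mulr_gt0.
  pose u := (s^-1)%:C%C * conjc (1 - w).
  have u1 : cnormsq u = 1.
    rewrite cnormsqM /u (_ : cnormsq (conjc (1 - w)) = s ^+ 2); last first.
      by rewrite s2; case: (1 - w) => x y; rewrite /cnormsq /= sqrrN.
    by rewrite /cnormsq /= expr0n addr0 -exprMn mulVf ?expr1n // lt0r_neq0.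
  apply: (multiplier_bound (u := u)) => //; first by rewrite u1.
  rewrite symbol_form //; last exact: adj_sym.
  have -> : complex.Re (u * (1 - w)) = s.
    rewrite -mulrA conjc_mul_cnormsq Re_mul_real -s2 /= expr2 mulrA mulVf ?mul1r //.
    exact: lt0r_neq0.
  have lower : - (lam * S) <=
     2^-1 * \sum_i \sum_j adj G i j * complex.Re (u * w ^+ m i j) * cnormsq (v i - v j).
    rewrite lerNl; apply: le_trans absS; rewrite -mulrN ler_wpM2l // -sumrN.
    apply: ler_sum => i _; rewrite -sumrN; apply: ler_sum => j _.
    rewrite -mulNr ler_wpM2r ?cnormsq_ge0 //.
    apply: le_trans (ler_norm _) _; rewrite normrN normrM ler_piMr //.
    apply: Re_le_cnormsq; rewrite cnormsqM u1 mul1r cnormsqX exprn_ile1 ?cnormsq_ge0 //.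
  have : kappa * S <= delta^-1 * s * S.
    by rewrite ler_wpM2r // mulrC ler_pdivlMr.
  have := ler_wpM2r S0 cA; rewrite mulrBl -/S; lra.
apply: (multiplier_bound (u := 1)) => //; first by rewrite /cnormsq /= expr1n expr0n addr0.
rewrite symbol_form //; last exact: adj_sym.
rewrite mul1r -/S.
have re0 : 0 <= complex.Re (1 - w).
  have := Re_le_cnormsq w1; case: (w) => x y /=; rewrite ler_norml => /andP[]; lra.
have lower : c1 * S - eta * (lam * S) <=
   2^-1 * \sum_i \sum_j adj G i j * complex.Re (1 * w ^+ m i j) * cnormsq (v i - v j).
  rewrite lerBlDr; apply: le_trans tauS _.
  apply: le_trans (lerD (lexx _) (ler_wpM2l (ltW eta0) absS)).
  rewrite mulrCA -mulrDr ler_wpM2l // mulr_sumr -big_split; apply: ler_sum => i _ /=.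
  rewrite mulr_sumr -big_split; apply: ler_sum => j _ /=.
  rewrite mulrA -mulrDl ler_wpM2r ?cnormsq_ge0 // mul1r.
  have [rho [beta [-> h1 h2]]] := expr_near_one w1 near d0 k0 kk' small (mtau i j).
  exact: robust.
have etal : eta * (lam * S) <= c1 / 2 * S.
  rewrite mulrA ler_wpM2r // /eta mulrAC ler_pdivrMr; last by rewrite mulr_gt0 // ltr_wpDl.
  have : 0 < c1 / 2 by rewrite divr_gt0.
  have -> : c1 / 2 * (2 * (lam + 1)) = c1 * lam + c1 by field.
  lra.
have : 0 <= delta^-1 * complex.Re (1 - w) * S by rewrite !mulr_ge0 // invr_ge0 ltW.
have := ler_wpM2r S0 cB; lra.
Qed.

(** * Parseval identity and the energy of a finite sequence *)

Definition zeta {R : realType} (N : nat) : R[i] :=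
  (cos (2 * pi / N%:R) +i* sin (2 * pi / N%:R))%C.

Lemma zeta_expr (R : realType) N k :
  zeta N ^+ k = (cos (k%:R * (2 * pi / N%:R)) +i* sin (k%:R * (2 * pi / N%:R)))%C :> R[i].
Proof. exact: cis_expr. Qed.

Lemma zeta_exprN (R : realType) N : (0 < N)%N -> zeta N ^+ N = 1 :> R[i].
Proof.
move=> N0; rewrite zeta_expr mulrC divfK ?pnatr_eq0 -?lt0n // mulr_natl.
by rewrite cos2pi sin2pi.
Qed.

Lemma zeta_expr_neq1 (R : realType) N d : (0 < d < N)%N -> zeta N ^+ d != 1 :> R[i].
Proof.
move=> /andP[d0 dN]; have N0 : (0 < N)%N by exact: leq_trans dN.
have x0 : 0 < sin (d%:R * (pi / N%:R)) :> R.
  apply: sin_gt0_pi; rewrite mulr_gt0 ?divr_gt0 ?pi_gt0 ?ltr0n //= mulrCA.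
  by rewrite gtr_pMr ?pi_gt0 // ltr_pdivrMr ?ltr0n // mul1r ltr_nat.
rewrite zeta_expr eq_complex /= negb_and; apply/orP; left.
have -> : d%:R * (2 * pi / N%:R) = (d%:R * (pi / N%:R)) *+ 2 :> R by rewrite mulr2n; ring.
rewrite cos_mulr2n cos2sin2 mulrnBl; apply/eqP => h.
have : sin (d%:R * (pi / N%:R)) ^+ 2 = 0 :> R by rewrite !mulr2n in h; lra.
by move/eqP; rewrite sqrf_eq0 gt_eqF.
Qed.

Lemma conjc_zeta (R : realType) N : conjc (zeta N) * zeta N = 1 :> R[i].
Proof. by rewrite conjc_mul_cnormsq /cnormsq /= cos2Dsin2. Qed.

Lemma conjc_eq1 (R : realType) (z : R[i]) : conjc z = 1 -> z = 1.
Proof. by case: z => a b [-> /eqP]; rewrite oppr_eq0 => /eqP ->. Qed.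

(** A geometric sum whose ratio is an [N]-th root of unity. *)
Lemma zeta_orthogonal (R : realType) N k l : (k < N)%N -> (l < N)%N ->
  \sum_(j < N) (conjc (zeta N) ^+ k * zeta N ^+ l) ^+ j = (N * (k == l))%:R :> R[i].
Proof.
move=> kN lN; have N0 : (0 < N)%N by exact: leq_trans kN.
set q := conjc _ ^+ k * _.
have [kl|kl] := eqVneq k l.
  rewrite muln1 (eq_bigr (fun=> 1)) ?sumr_const ?card_ord // => j _.
  by rewrite /q kl -exprMn conjc_zeta !expr1n.
rewrite muln0.
have q1 : q != 1.
  have [lk|lk|lk] := ltngtP k l; last by rewrite lk eqxx in kl.
    rewrite /q -(subnKC (ltnW lk)) exprD mulrA -exprMn conjc_zeta expr1n mul1r.
    by apply: zeta_expr_neq1; rewrite subn_gt0 lk; apply: leq_ltn_trans lN; rewrite leq_subr.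
  rewrite /q -(subnKC (ltnW lk)) exprD mulrAC -exprMn conjc_zeta expr1n mul1r.
  rewrite -rmorphXn; apply: contraNneq (@zeta_expr_neq1 R N (k - l) _) => [h|].
    by apply/eqP; exact: conjc_eq1 h.
  by rewrite subn_gt0 lk; apply: leq_ltn_trans kN; rewrite leq_subr.
apply: (mulfI (x := q - 1)); first by rewrite subr_eq0.
rewrite mulr0 -subrX1 /q exprMn -!exprM ![(_ * N)%N]mulnC !exprM -rmorphXn.
by rewrite zeta_exprN // rmorph1 !expr1n mulr1 subrr.
Qed.

Lemma dft_parseval (R : realType) N (c : nat -> R[i]) :
  \sum_(j < N) cnormsq (\sum_(k < N) c k * (zeta N ^+ j) ^+ k) =
  N%:R * \sum_(k < N) cnormsq (c k).
Proof.
apply: complexI; rewrite rmorphM rmorph_nat !rmorph_sum /=.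
have e j : ((cnormsq (\sum_(k < N) c k * (zeta N ^+ j) ^+ k))%:C)%C =
    \sum_(k < N) \sum_(l < N) conjc (c k) * c l * (conjc (zeta N) ^+ k * zeta N ^+ l) ^+ j.
  rewrite -conjc_mul_cnormsq rmorph_sum mulr_suml; apply: eq_bigr => k _ /=.
  rewrite mulr_sumr; apply: eq_bigr => l _.
  rewrite rmorphM !rmorphXn exprMn -!exprM [(k * _)%N]mulnC [(l * _)%N]mulnC /=; ring.
under eq_bigr do rewrite e.
rewrite exchange_big mulr_sumr /=; apply: eq_bigr => k _.
rewrite exchange_big (bigD1 k) //= [X in _ + X]big1 ?addr0 => [|l lk].
  by rewrite -mulr_sumr zeta_orthogonal // eqxx muln1 -conjc_mul_cnormsq mulrC.
have /negPf lk' : (k : nat) != l by rewrite eq_sym.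
by rewrite -mulr_sumr zeta_orthogonal // lk' muln0 mulr0.
Qed.

(** Filling with 0 before time 0 makes a delay by [d] steps act on generating functions
    as multiplication by [w ^+ d]. *)
Definition lag {T : zmodType} (d : nat) (x : nat -> T) (k : nat) : T :=
  if (k < d)%N then 0 else x (k - d)%N.

Lemma lag_transform (R : realType) (w : R[i]) (d N0 N : nat) (x : nat -> R) :
  (forall k, (N0 <= k)%N -> x k = 0) -> (N0 + d <= N)%N ->
  \sum_(k < N) (lag d x k)%:C%C * w ^+ k = w ^+ d * \sum_(k < N) (x k)%:C%C * w ^+ k.
Proof.
move=> x0 N0N.
rewrite -(big_mkord predT (fun k => (lag d x k)%:C%C * w ^+ k)).
rewrite -(big_mkord predT (fun k => (x k)%:C%C * w ^+ k)).
have dN : (d <= N)%N by apply: leq_trans N0N; rewrite leq_addl.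
rewrite (big_cat_nat (leq0n d) dN) /= big_nat_cond big1 ?add0r => [|k]; last first.
  by rewrite andbT => /andP[_ kd]; rewrite /lag kd mul0r.
rewrite [in RHS](big_cat_nat (leq0n (N - d)) (leq_subr _ _)) /=.
rewrite [X in _ = _ * (_ + X)]big_nat_cond [X in _ = _ * (_ + X)]big1 ?addr0 => [|k]; last first.
  rewrite andbT => /andP[kN _]; rewrite x0 ?mul0r //.
  by apply: leq_trans kN; rewrite -(leq_add2r d) subnK.
rewrite -{1}(add0n d) big_addn mulr_sumr; apply: eq_bigr => k _.
by rewrite /lag ltnNge leq_addl /= addnK exprD mulrCA mulrC mulrCA mulrA.
Qed.

(** The defect of [x] in the backward Euler discretization of the delay equation;
    the implicit difference quotient has a symbol of nonnegative real part on the
    whole unit disc. *)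
Definition scheme {R : realType} {n : nat} (a : 'I_n -> 'I_n -> R)
    (m : 'I_n -> 'I_n -> nat) (delta : R) (x : 'I_n -> nat -> R) (i : 'I_n) (k : nat) : R :=
  delta^-1 * (x i k - lag 1 (x i) k) +
  \sum_j a i j * (lag (m i j) (x i) k - lag (m i j) (x j) k).

(** [symbol_bound] at the points [r * zeta ^+ j], summed over [j] by Parseval. The
    length [N] leaves room for the last delayed values, so that nothing wraps
    around. *)
Lemma scheme_energy (R : realType) (n : nat) (a : 'I_n -> 'I_n -> R)
    (m : 'I_n -> 'I_n -> nat) (delta c r : R) (x : 'I_n -> nat -> R) (N0 N : nat) :
  (forall w (v : 'I_n -> R[i]), cnormsq w <= 1 -> \sum_i v i = 0 ->
    c ^+ 2 * \sum_i cnormsq (v i) <= \sum_i cnormsq (symbol a m delta w v i)) ->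
  0 <= r <= 1 -> (forall k, \sum_i x i k = 0) ->
  (forall i k, (N0 <= k)%N -> x i k = 0) ->
  (N0 < N)%N -> (forall i j, (N0 + m i j <= N)%N) ->
  c ^+ 2 * \sum_(k < N) \sum_i (r ^+ k * x i k) ^+ 2 <=
  \sum_(k < N) \sum_i (r ^+ k * scheme a m delta x i k) ^+ 2.
Proof.
move=> sb /andP[r0 r1] x_mean x_supp N0N mN.
have Npos : (0 < N)%N by exact: leq_trans N0N.
pose w j : R[i] := r%:C%C * zeta N ^+ j.
pose T (f : nat -> R) j : R[i] := \sum_(k < N) (f k)%:C%C * w j ^+ k.
have zeta1 : cnormsq (zeta N : R[i]) = 1 by rewrite /cnormsq /= cos2Dsin2.
have w1 j : cnormsq (w j) <= 1.
  rewrite cnormsqM cnormsqX zeta1 expr1n mulr1 /cnormsq /= expr0n addr0.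
  by rewrite exprn_ile1.
have parseval f : \sum_(j < N) cnormsq (T f j) = N%:R * \sum_(k < N) (r ^+ k * f k) ^+ 2.
  have := dft_parseval N (fun k => (r ^+ k * f k)%:C%C); congr (_ = _).
    apply: eq_bigr => j _; congr cnormsq; apply: eq_bigr => k _.
    by rewrite /w exprMn rmorphM rmorphXn /=; ring.
  by congr (_ * _); apply: eq_bigr => k _; rewrite /cnormsq /= expr0n addr0.
have Tscheme i j : T (scheme a m delta x i) j = symbol a m delta (w j) (fun i => T (x i) j) i.
  have lagT i' d : (N0 + d <= N)%N -> T (lag d (x i')) j = w j ^+ d * T (x i') j.
    by move=> ?; apply: (@lag_transform _ _ _ N0) => // k; exact: x_supp.
  rewrite /symbol mulrBr mulr1 mulrBl -mulrA.
  have -> : w j * T (x i) j = T (lag 1 (x i)) j by rewrite lagT ?addn1 // expr1.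
  have -> : \sum_j0 (a i j0)%:C%C * w j ^+ m i j0 * (T (x i) j - T (x j0) j) =
      \sum_j0 (a i j0)%:C%C * (T (lag (m i j0) (x i)) j - T (lag (m i j0) (x j0)) j).
    by apply: eq_bigr => l _; rewrite !lagT // -mulrA mulrBr.
  rewrite /T -mulrBr -sumrB mulr_sumr.
  under [in RHS]eq_bigr do rewrite -mulrBl.
  under [X in _ = _ + X]eq_bigr => l _.
    rewrite -sumrB mulr_sumr; over.
  rewrite exchange_big -big_split /=; apply: eq_bigr => k _.
  rewrite /scheme rmorphD rmorphM rmorphB rmorph_sum mulrDl /= mulrA; congr (_ + _).
  rewrite mulr_suml; apply: eq_bigr => l _; rewrite rmorphM rmorphB /=; ring.
have Tmean j : \sum_i T (x i) j = 0.
  rewrite /T exchange_big big1 // => k _ /=.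
  by rewrite -mulr_suml -rmorph_sum x_mean mul0r.
have : c ^+ 2 * \sum_(j < N) \sum_i cnormsq (T (x i) j) <=
    \sum_(j < N) \sum_i cnormsq (T (scheme a m delta x i) j).
  rewrite mulr_sumr; apply: ler_sum => j _.
  under [leRHS]eq_bigr do rewrite Tscheme.
  exact: sb.
rewrite exchange_big [leRHS]exchange_big /=.
under eq_bigr do rewrite parseval.
under [leRHS]eq_bigr do rewrite parseval.
rewrite -!mulr_sumr mulrCA ler_pM2l ?ltr0n //.
by rewrite exchange_big [leRHS]exchange_big.
Qed.

(** * Geometrically weighted energies *)

Definition energy {R : realType} (r : R) (f : nat -> R) (T : nat) : R :=
  \sum_(k < T) (r ^+ k * f k) ^+ 2.

Lemma energyS (R : realType) (r : R) f T :
  energy r f T.+1 = energy r f T + (r ^+ T * f T) ^+ 2.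
Proof. by rewrite /energy big_ord_recr. Qed.

Lemma energy_ge0 (R : realType) (r : R) f T : 0 <= energy r f T.
Proof. by apply: sumr_ge0 => k _; exact: sqr_ge0. Qed.

Lemma energy_mono (R : realType) (r : R) f T T' : (T <= T')%N -> energy r f T <= energy r f T'.
Proof.
move=> /subnK <-; elim: (T' - T)%N => [|d IH] //.
by rewrite addSn energyS; apply: le_trans IH _; rewrite lerDl sqr_ge0.
Qed.

Lemma energy_rescale (R : realType) (r s : R) f T : 1 <= s ->
  energy (r * s) f T <= (s ^+ 2) ^+ T * energy r f T.
Proof.
move=> s1; rewrite /energy mulr_sumr; apply: ler_sum => k _.
have -> : ((r * s) ^+ k * f k) ^+ 2 = (s ^+ 2) ^+ k * (r ^+ k * f k) ^+ 2.
  by rewrite exprAC !exprMn; ring.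
rewrite ler_wpM2r ?sqr_ge0 // ler_weXn2l //; last exact: ltnW.
by rewrite expr_ge1 // (le_trans ler01).
Qed.

(** The recurrence says that [energy - C1] gains a factor of at least
    [1 / (1 - 1 / C2)] over each block of [H] steps. Once positive it would grow at
    that rate, and [g] is too small for it. *)
Lemma energy_growth_dichotomy (R : realType) (f : nat -> R) (H : nat) (r C1 C2 B g : R) :
  1 <= C2 -> 0 <= B -> 0 <= g -> (1 - C2^-1) * g < 1 ->
  (forall T, energy r f T <= C1 + C2 * (energy r f T - energy r f (T - H))) ->
  (forall j, energy r f (j * H) <= C1 + B * g ^+ j) ->
  forall j, energy r f (j * H) <= C1.
Proof.
move=> C21 B0 g0 qg1 rec gr j; set q := 1 - C2^-1 in qg1 *.
have C20 : 0 < C2 by exact: lt_le_trans C21.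
have q0 : 0 <= q by rewrite subr_ge0 invf_le1.
pose Y j := energy r f (j * H) - C1.
have Yrec i : Y i <= q * Y i.+1.
  have := rec (i.+1 * H)%N; rewrite {2}mulSn addKn => h.
  rewrite -(ler_pM2l C20).
  have -> : C2 * (q * Y i.+1) = (C2 - 1) * Y i.+1 by rewrite /q; field; exact: lt0r_neq0.
  rewrite /Y; lra.
have Yit i : Y j <= q ^+ i * Y (j + i)%N.
  elim: i => [|i IH]; first by rewrite expr0 mul1r addn0.
  by apply: le_trans IH _; rewrite addnS exprSr -mulrA ler_wpM2l ?exprn_ge0.
have Ylim i : Y j <= B * g ^+ j * (q * g) ^+ i.
  apply: le_trans (Yit i) _.
  have -> : B * g ^+ j * (q * g) ^+ i = q ^+ i * (B * g ^+ (j + i)).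
    by rewrite exprMn exprD; ring.
  by rewrite ler_wpM2l ?exprn_ge0 // lerBlDl.
suff : Y j <= 0 by rewrite subr_le0.
have cv : (fun i => B * g ^+ j * (q * g) ^+ i) @ \oo --> (B * g ^+ j * 0).
  by apply: cvgM; [exact: cvg_cst | apply: cvg_expr; rewrite ger0_norm ?mulr_ge0].
rewrite mulr0 in cv.
have e : lim ((fun i => B * g ^+ j * (q * g) ^+ i) @ \oo) = 0 by apply/cvg_lim.
rewrite -e; apply: limr_ge; first by apply/cvg_ex; exists 0.
by near=> i; exact: Ylim.
Unshelve. all: by end_near. Qed.

(** Continuation in the weight. At [r = s ^- i] with [i] large the energy is bounded
    because [f] grows at most exponentially, and a bound at [r] gives growth of rate
    at most [s ^+ 2] at [r * s], which [energy_growth_dichotomy] improves to a bound.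
    The same step [s] works for every [r], so finitely many steps reach [r = 1]. *)
Lemma energy_sweep (R : realType) (f : nat -> R) (H : nat) (C1 C2 B Gam : R) :
  (0 < H)%N -> 0 <= C1 -> 1 <= C2 -> 0 < Gam -> 
  (forall k, `|f k| <= B * Gam ^+ k) ->
  (forall r T, 0 <= r <= 1 ->
     energy r f T <= C1 + C2 * (energy r f T - energy r f (T - H))) ->
  f @ \oo --> (0 : R).
Proof.
move=> H0 C10 C21 Gam0 fB rec.
have C20 : 0 < C2 by exact: lt_le_trans C21.
have B0 : 0 <= B by have := le_trans (normr_ge0 _) (fB 0%N); rewrite expr0 mulr1.
set q := 1 - C2^-1.
have q0 : 0 <= q by rewrite subr_ge0 invf_le1.
have q1 : q < 1 by rewrite gtrBl invr_gt0.
(* The energy weights are squared and a block has [H] steps. *)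
have [s s1 sq] : exists2 s : R, 1 < s & q * (s ^+ 2) ^+ H < 1.
  have cv : q * (s ^+ 2) ^+ H @[s --> (1 : R)] --> q * (1 ^+ 2) ^+ H.
    apply: cvgM; first exact: cvg_cst.
    by apply: (@cvg_comp _ _ _ (fun s : R => s ^+ 2) (fun s => s ^+ H)); exact: exprn_continuous.
  rewrite !expr1n mulr1 in cv.
  have : \forall s \near (1 : R)^'+, 1 < s /\ q * (s ^+ 2) ^+ H < 1.
    apply: filterI; first exact: nbhs_right_gt.
    by apply: (@cvg_within _ (nbhs (1 : R))); exact: (cvgr_lt _ cv).
  by move=> /filter_ex[s [? ?]]; exists s.
have s0 : 0 < s by exact: lt_trans s1.
have bounded_all i : (exists C, forall T, energy (s^-1 ^+ i) f T <= C) ->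
    forall T, energy (s^-1 ^+ i) f T <= C1.
  move=> [C hC] T; apply: le_trans (_ : energy (s^-1 ^+ i) f (T * H) <= _).
    by apply: energy_mono; rewrite leq_pmulr.
  have r01 : 0 <= s^-1 ^+ i <= 1.
    have si : 0 <= s^-1 by rewrite invr_ge0 ltW.
    by rewrite exprn_ge0 // exprn_ile1 // invf_le1 // ltW.
  have C0 : 0 <= C by apply: le_trans (hC 0%N); exact: energy_ge0.
  apply: (@energy_growth_dichotomy _ f H _ C1 C2 C 1) => //; first by rewrite mulr1.
    by move=> T'; exact: rec.
  by move=> j; rewrite expr1n mulr1 (le_trans (hC _)) // lerDr.
have step i : (exists C, forall T, energy (s^-1 ^+ i.+1) f T <= C) ->
    exists C, forall T, energy (s^-1 ^+ i) f T <= C.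
  move=> /bounded_all hC; exists C1 => T.
  apply: le_trans (_ : energy (s^-1 ^+ i) f (T * H) <= _).
    by apply: energy_mono; rewrite leq_pmulr.
  have r01 : 0 <= s^-1 ^+ i <= 1.
    have si : 0 <= s^-1 by rewrite invr_ge0 ltW.
    by rewrite exprn_ge0 // exprn_ile1 // invf_le1 // ltW.
  apply: (@energy_growth_dichotomy _ f H _ C1 C2 C1 ((s ^+ 2) ^+ H)) => //.
  - by rewrite !exprn_ge0 // ltW.
  - by move=> T'; exact: rec.
  - move=> j; apply: le_trans (_ : C1 * ((s ^+ 2) ^+ H) ^+ j <= _); last by rewrite lerDr.
    have -> : s^-1 ^+ i = s^-1 ^+ i.+1 * s.
      by rewrite exprSr divfK // lt0r_neq0.
    apply: le_trans (energy_rescale _ _ _ (ltW s1)) _.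
    rewrite [(j * H)%N]mulnC exprM mulrC.
    by rewrite ler_wpM2r ?hC // !exprn_ge0 // ltW.
have start : exists i, forall T, energy (s^-1 ^+ i) f T <= 2 * B ^+ 2.
  have [i hi] : exists i, s^-1 ^+ i * Gam <= 2^-1.
    have cv : s^-1 ^+ i * Gam @[i --> \oo] --> 0 * Gam.
      apply: cvgM; last exact: cvg_cst.
      by apply: cvg_expr; rewrite ger0_norm ?invr_ge0 ?ltW // invf_lt1.
    rewrite mul0r in cv.
    have /filter_ex[i hi] : \forall i \near \oo, s^-1 ^+ i * Gam <= 2^-1.
      by apply: (cvgr_le _ cv); rewrite invr_gt0.
    by exists i.
  exists i => T.
  have : energy (s^-1 ^+ i) f T <= (2 - 2 * 2^-1 ^+ T) * B ^+ 2.
    elim: T => [|T IH]; first by rewrite /energy big_ord0 expr0 mulr1 subrr mul0r.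
    rewrite energyS; apply: le_trans (lerD IH (_ : _ <= 2^-1 ^+ T * B ^+ 2)) _; last first.
      have -> : 2 * 2^-1 ^+ T.+1 = 2^-1 ^+ T :> R by rewrite exprS; field.
      by rewrite -mulrDl ler_wpM2r ?sqr_ge0 //; lra.
    have h0 : 0 <= s^-1 ^+ i by rewrite exprn_ge0 // invr_ge0 ltW.
    have : `|(s^-1 ^+ i) ^+ T * f T| <= 2^-1 ^+ T * B.
      have h1 : 0 <= (s^-1 ^+ i) ^+ T by exact: exprn_ge0.
      rewrite normrM (ger0_norm h1); apply: le_trans (ler_wpM2l h1 (fB T)) _.
      rewrite mulrCA mulrC -exprMn ler_wpM2r // lerXn2r ?nnegrE ?(mulr_ge0 h0 (ltW Gam0)) //.
    move=> h; rewrite -real_normK ?num_real //.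
    apply: le_trans (_ : (2^-1 ^+ T * B) ^+ 2 <= _).
      by rewrite lerXn2r ?nnegrE // mulr_ge0 // exprn_ge0.
    rewrite exprMn ler_wpM2r ?sqr_ge0 // expr2 ler_piMl ?exprn_ge0 //.
    by rewrite exprn_ile1 // invf_le1 // ler1n.
  move=> h; apply: le_trans h _; rewrite ler_wpM2r ?sqr_ge0 // gerBl.
  by rewrite mulr_ge0 // exprn_ge0.
have [C hC] : exists C, forall T, energy 1 f T <= C.
  have [i hi] := start.
  suff : exists C, forall T, energy (s^-1 ^+ 0) f T <= C by rewrite expr0.
  have : exists C, forall T, energy (s^-1 ^+ i) f T <= C by exists (2 * B ^+ 2).
  by elim: i {hi} => // i IH /step.
have cvs : cvgn (series (fun k => f k ^+ 2)).
  apply: nondecreasing_is_cvgn.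
    apply/nondecreasing_seqP => k; rewrite /series /= big_nat_recr //= lerDl sqr_ge0 //.
  exists C => _ [T _ <-]; apply: le_trans (hC T).
  rewrite /series /= big_mkord /energy le_eqVlt; apply/orP; left; apply/eqP.
  by apply: eq_bigr => k _; rewrite expr1n mul1r.
have := cvg_series_cvg_0 cvs.
move=> /cvgrPdist_lt h; apply/cvgrPdist_lt => eps eps0.
have := h (eps ^+ 2); rewrite exprn_gt0 // => /(_ isT).
apply: filterS => k; rewrite !sub0r !normrN normrX => hk.
by rewrite -(ltr_pXn2r (n:=2)) ?nnegrE // ltW.
Qed.

(** * Decay of the envelope of a scheme *)

Lemma sqr_sum_le (R : realType) (I : finType) (x : I -> R) :
  (\sum_i x i) ^+ 2 <= #|I|%:R * \sum_i x i ^+ 2.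
Proof.
rewrite expr2 mulr_suml mulr_natl -sumr_const.
have -> : \sum_(i : I) \sum_j x j ^+ 2 =
    2^-1 * \sum_i \sum_j (x i ^+ 2 + x j ^+ 2).
  under [in RHS]eq_bigr do rewrite big_split /=.
  rewrite big_split /= [X in _ * (X + _)]exchange_big /=; lra.
rewrite mulr_sumr; apply: ler_sum => i _; rewrite !mulr_sumr; apply: ler_sum => j _.
have := sqr_ge0 (x i - x j); rewrite sqrrB; lra.
Qed.

Lemma energy_le (R : realType) (r : R) f g T : 0 <= r ->
  (forall k, (k < T)%N -> `|f k| <= g k) -> energy r f T <= energy r g T.
Proof.
move=> r0 fg; apply: ler_sum => k _.
have h0 : 0 <= r ^+ k by exact: exprn_ge0.
have g0 : 0 <= g k by exact: le_trans (normr_ge0 _) (fg _ (ltn_ord k)).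
rewrite !exprMn ler_wpM2l ?exprn_ge0 // -[f k ^+ 2]real_normK ?num_real //.
by rewrite lerXn2r ?nnegrE // fg.
Qed.

Lemma energyZ (R : realType) (r c : R) f T :
  energy r (fun k => c * f k) T = c ^+ 2 * energy r f T.
Proof. by rewrite /energy mulr_sumr; apply: eq_bigr => k _; rewrite -exprMn; congr (_ ^+ 2); ring. Qed.

Lemma energyD (R : realType) (r : R) f g T :
  energy r (fun k => f k + g k) T <= 2 * (energy r f T + energy r g T).
Proof.
rewrite /energy -big_split mulr_sumr; apply: ler_sum => k _ /=.
by have := sqr_ge0 (r ^+ k * f k - r ^+ k * g k); rewrite sqrrB mulrDr sqrrD; lra.
Qed.

Lemma energy_sum (R : realType) (r : R) (I : finType) (F : I -> nat -> R) T :
  energy r (fun k => \sum_i F i k) T <= #|I|%:R * \sum_i energy r (F i) T.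
Proof.
rewrite /energy exchange_big mulr_sumr; apply: ler_sum => k _ /=.
by rewrite mulr_sumr; exact: sqr_sum_le.
Qed.

(** A delay by [d] only gains, by the factor [r ^+ d <= 1]. *)
Lemma energy_lag (R : realType) (r : R) d f T : 0 <= r <= 1 ->
  energy r (lag d f) T <= energy r f T.
Proof.
move=> /andP[r0 r1]; apply: le_trans (energy_mono r f (leq_subr d T)).
elim: T => [|T IH]; first by rewrite /energy !big_ord0.
rewrite energyS {2}/lag; case: ltnP => dT.
  by rewrite mulr0 expr0n addr0; apply: le_trans IH _; apply: energy_mono; rewrite leq_sub2r.
rewrite subSn // energyS lerD // !exprMn ler_wpM2r ?sqr_ge0 //.
by rewrite lerXn2r ?nnegrE ?exprn_ge0 // ler_wiXn2l // leq_subr.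
Qed.

(** A time in the [k]-th cell, delayed by [tau_ij], falls in the cell [k - m i j] or
    [k - (m i j).+1], so these are the values of an envelope that bound the right-hand
    side of the equation. The number of terms does not depend on the time step. *)
Definition window_sum {R : realType} {n : nat} (m : 'I_n -> 'I_n -> nat)
    (f : nat -> R) (k : nat) : R :=
  \sum_i \sum_j (lag (m i j) f k + lag (m i j).+1 f k).

(** [2 * n ^ 2] is the number of terms of [window_sum]. *)
Lemma energy_window_sum (R : realType) (n : nat) (m : 'I_n -> 'I_n -> nat) (r : R) f T :
  0 <= r <= 1 ->
  energy r (window_sum m f) T <= (2 * n%:R ^+ 2) ^+ 2 * energy r f T.
Proof.
move=> r01; rewrite /window_sum; apply: le_trans (energy_sum _ _ _) _.
set E := energy r f T; rewrite card_ord.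
have inner (i : 'I_n) : energy r (fun k => \sum_j (lag (m i j) f k + lag (m i j).+1 f k)) T
    <= n%:R * (n%:R * (4 * E)).
  apply: le_trans (energy_sum _ _ _) _; rewrite card_ord ler_wpM2l //.
  rewrite [leRHS]mulr_natl -[X in _ *+ X]card_ord -sumr_const; apply: ler_sum => j _.
  apply: le_trans (energyD _ _ _ _) _.
  have := energy_lag (m i j) f T r01; have := energy_lag (m i j).+1 f T r01; rewrite -/E; lra.
apply: le_trans (ler_wpM2l (ler0n _ _) (ler_sum _ (fun i _ => inner i))) _.
by rewrite sumr_const card_ord -[X in _ * X]mulr_natl; rewrite le_eqVlt; apply/orP; left; apply/eqP; ring.
Qed.

Lemma lag_ge0 (R : realType) d (f : nat -> R) k : (forall k, 0 <= f k) -> 0 <= lag d f k.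
Proof. by move=> f0; rewrite /lag; case: ifP. Qed.

Lemma window_sum_ge0 (R : realType) (n : nat) (m : 'I_n -> 'I_n -> nat) (f : nat -> R) k :
  (forall k, 0 <= f k) -> 0 <= window_sum m f k.
Proof.
by move=> f0; apply: sumr_ge0 => i _; apply: sumr_ge0 => j _; rewrite addr_ge0 // lag_ge0.
Qed.

Lemma window_sum_ge (R : realType) (n : nat) (m : 'I_n -> 'I_n -> nat) (f : nat -> R) k i j :
  (forall k, 0 <= f k) -> lag (m i j) f k + lag (m i j).+1 f k <= window_sum m f k.
Proof.
move=> f0; rewrite /window_sum (bigD1 i) //= (bigD1 j) //= -addrA lerDl.
rewrite addr_ge0 ?sumr_ge0 // => [j' _|i' _]; first by rewrite addr_ge0 // lag_ge0.
by apply: sumr_ge0 => j' _; rewrite addr_ge0 // lag_ge0.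
Qed.

Lemma window_sum_causal (R : realType) (n : nat) (m : 'I_n -> 'I_n -> nat) (f g : nat -> R) k :
  (forall j, (j <= k)%N -> f j = g j) -> window_sum m f k = window_sum m g k.
Proof.
move=> fg; apply: eq_bigr => i _; apply: eq_bigr => j _; rewrite /lag.
by case: ifP => _; case: ifP => _ //; rewrite ?fg ?leq_subr.
Qed.

Lemma window_sum_le (R : realType) (n : nat) (m : 'I_n -> 'I_n -> nat) (f : nat -> R) k B :
  (forall d, lag d f k <= B) -> window_sum m f k <= 2 * n%:R ^+ 2 * B.
Proof.
move=> fB; have -> : 2 * n%:R ^+ 2 * B = \sum_(i < n) \sum_(j < n) (B + B).
  by rewrite !sumr_const !card_ord -[(B + B) *+ n]mulr_natl -mulr_natl; ring.
by apply: ler_sum => i _; apply: ler_sum => j _; rewrite lerD.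
Qed.

Lemma scheme_le_window_sum (R : realType) (n : nat) (a : 'I_n -> 'I_n -> R)
    (m : 'I_n -> 'I_n -> nat) (delta : R) (x : 'I_n -> nat -> R) (f : nat -> R) (H : nat) i k :
  0 < delta -> (forall i, m i i = 0%N) -> (forall k, 0 <= f k) ->
  (0 < H)%N -> (forall i j, (m i j <= H)%N) ->
  (forall i d, (d <= H)%N -> `|lag d (x i) k| <= lag d f k) ->
  `|scheme a m delta x i k| <=
    (delta^-1 + 2 * \sum_i \sum_j `|a i j|) * window_sum m f k.
Proof.
move=> d0 m0 f0 H0 mH xf; set W := window_sum m f k.
have lagW i' j' : lag (m i' j') f k <= W.
  by apply: le_trans (window_sum_ge m k i' j' f0); rewrite lerDl lag_ge0.
have lag0 (g : nat -> R) : lag 0 g k = g k by rewrite /lag subn0.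
have x0 : `|x i k - lag 1 (x i) k| <= W.
  apply: le_trans (ler_normB _ _) _.
  have := window_sum_ge m k i i f0; rewrite m0 -/W.
  have := xf i 1%N H0; have := xf i 0%N (leq0n _); rewrite !lag0; lra.
rewrite mulrDl; apply: le_trans (ler_normD _ _) _; apply: lerD.
  by rewrite normrM gtr0_norm ?invr_gt0 // ler_wpM2l // invr_ge0 ltW.
apply: le_trans (ler_norm_sum _ _ _) _.
apply: le_trans (_ : \sum_j `|a i j| * (2 * W) <= _).
  apply: ler_sum => j _; rewrite normrM ler_wpM2l //; apply: le_trans (ler_normB _ _) _.
  have := xf i _ (mH i j); have := xf j _ (mH i j); have := lagW i j; lra.
rewrite -mulr_suml mulrCA mulrA ler_wpM2r ?window_sum_ge0 // ler_wpM2l //.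
rewrite [leRHS](bigD1 i) //= lerDl; apply: sumr_ge0 => i' _; exact: sumr_ge0.
Qed.

(** [window_sum] may contain [M k] itself, through the vanishing delays, so the
    recurrence is implicit; the smallness of [e] resolves it. *)
Lemma envelope_exp_bound (R : realType) (n : nat) (m : 'I_n -> 'I_n -> nat)
    (e : R) (H : nat) (u : 'I_n -> nat -> R) (M : nat -> R) :
  (0 < H)%N -> 0 <= e -> e * (2 * n%:R ^+ 2) <= 2^-1 -> (forall k, 0 <= M k) ->
  (forall i k, `|u i k.+1| <= M k) ->
  (forall k, (H <= k)%N -> M k <= \sum_i `|u i k| + e * window_sum m M k) ->
  exists B, forall k, M k <= B * (2 * n%:R + 1) ^+ k.
Proof.
move=> H0 e0 et M0 uM Mrec; set Gam : R := 2 * n%:R + 1.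
have Gam1 : 1 <= Gam by rewrite lerDr mulr_ge0.
exists (\sum_(k < H) M k) => k; set B := \sum_(k < H) M k.
have B0 : 0 <= B by apply: sumr_ge0 => j _; exact: M0.
elim/ltn_ind: k => k IH.
have [kH|Hk] := ltnP k H.
  apply: le_trans (_ : B <= _); last by rewrite ler_peMr // exprn_ege1.
  by rewrite /B (bigD1 (Ordinal kH)) //= lerDl; apply: sumr_ge0 => j _; exact: M0.
have k0 : (0 < k)%N by exact: leq_trans Hk.
rewrite leNgt; apply/negP => big.
have lagM d : lag d M k <= M k.
  rewrite /lag; case: ltnP => // dk; case: d dk => [|d] dk; first by rewrite subn0.
  apply: le_trans (IH _ _) _; first by rewrite ltn_subrL k0.
  apply: ltW; apply: le_lt_trans big; rewrite ler_wpM2l // ler_weXn2l // leq_subr //.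
have h1 := window_sum_le m lagM.
have h2 : e * window_sum m M k <= 2^-1 * M k.
  apply: le_trans (ler_wpM2l e0 h1) _; rewrite mulrA ler_wpM2r //.
have h3 : \sum_i `|u i k| <= n%:R * (B * Gam ^+ k.-1).
  rewrite mulr_natl -[X in _ *+ X]card_ord -sumr_const; apply: ler_sum => i _.
  have := uM i k.-1; rewrite prednK // => h; apply: le_trans h (IH _ _).
  by rewrite prednK.
have h4 := Mrec _ Hk.
have : M k <= 2 * n%:R * (B * Gam ^+ k.-1) by lra.
have BG : 0 <= B * Gam ^+ k.-1 by rewrite mulr_ge0 // exprn_ge0 // (le_trans ler01).
move: big; rewrite -(prednK k0) /= exprS => big h.
have : B * (Gam * Gam ^+ k.-1) = 2 * n%:R * (B * Gam ^+ k.-1) + B * Gam ^+ k.-1.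
  have -> : 2 * n%:R = Gam - 1 by rewrite /Gam addrK.
  ring.
lra.
Qed.

(** The sequence [u] is cut to [[H, T)] and [scheme_energy] applied. Away from both
    ends the defect is that of [u], of relative size [e]; near the ends it is bounded
    by the nearby values of [M], whose energy is a constant at the start and
    [S T - S (T - H)] at the end. As [M] is comparable to [u], smallness of [e] absorbs
    the first contribution and leaves the recurrence required by [energy_sweep]. *)
Lemma discrete_decay (R : realType) (n : nat) (a : 'I_n -> 'I_n -> R)
    (m : 'I_n -> 'I_n -> nat) (delta c e : R) (H : nat)
    (u : 'I_n -> nat -> R) (M : nat -> R) :
  (forall w (v : 'I_n -> R[i]), cnormsq w <= 1 -> \sum_i v i = 0 ->
    c ^+ 2 * \sum_i cnormsq (v i) <= \sum_i cnormsq (symbol a m delta w v i)) ->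
  0 < c -> 0 < delta -> (forall i, m i i = 0%N) -> (forall i j, (m i j < H)%N) -> (0 < H)%N ->
  (forall k, \sum_i u i k = 0) ->
  (forall k, 0 <= M k) ->
  (forall i k, `|u i k| <= M k) ->
  (forall i k, `|u i k.+1| <= M k) ->
  (forall k, (H <= k)%N -> M k <= \sum_i `|u i k| + e * window_sum m M k) ->
  (forall i k, (H.*2 <= k)%N -> `|scheme a m delta u i k| <=
      e * lag 1 (window_sum m (window_sum m M)) k) ->
  0 <= e ->
  e ^+ 2 * (8 * n%:R ^+ 2 * (c ^+ 2)^-1 * (2 * n%:R ^+ 2) ^+ 4 + 4 * (2 * n%:R ^+ 2) ^+ 2) <= 2^-1 ->
  M @ \oo --> (0 : R).
Proof.
move=> sb c0 d0 m0 mH H0 u_mean M0 uM uM1 Mrec uscheme e0 esmall.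
set th : R := 2 * n%:R ^+ 2 in esmall.
have th0 : 0 <= th by rewrite mulr_ge0 // sqr_ge0.
have c2 : 0 < c ^+ 2 by exact: exprn_gt0.
have ci0 : 0 <= (c ^+ 2)^-1 by rewrite invr_ge0 ltW.
have [B MB] : exists B, forall k, M k <= B * (2 * n%:R + 1) ^+ k.
  apply: (envelope_exp_bound H0 e0 _ M0 uM1 Mrec).
  rewrite -/th -(ler_pXn2r (n:=2)) ?nnegrE ?mulr_ge0 // exprMn.
  have t1 : 0 <= e ^+ 2 * (8 * n%:R ^+ 2 * (c ^+ 2)^-1 * th ^+ 4).
    by rewrite !mulr_ge0 ?exprn_ge0 // invr_ge0 ltW.
  have -> : (2^-1 : R) ^+ 2 = 4^-1 by rewrite exprVn -natrX.
  by move: esmall; rewrite mulrDr; lra.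
pose beta := delta^-1 + 2 * \sum_i \sum_j `|a i j|.
pose C0 := energy 1 M H.*2.
pose C2 := 32 * n%:R ^+ 2 * (c ^+ 2)^-1 * beta ^+ 2 * th ^+ 2 + 1.
have C00 : 0 <= C0 by exact: energy_ge0.
have C2' : 0 <= 32 * n%:R ^+ 2 * (c ^+ 2)^-1 * beta ^+ 2 * th ^+ 2.
  apply: mulr_ge0; last exact: sqr_ge0.
  apply: mulr_ge0; last exact: sqr_ge0.
  by apply: mulr_ge0 => //; apply: mulr_ge0 => //; exact: sqr_ge0.
apply: (@energy_sweep R M H (4 * C0 + C2 * C0) C2 B (2 * n%:R + 1)) => //.
- by rewrite addr_ge0 ?mulr_ge0 // addr_ge0.
- by rewrite lerDr.
- by move=> k; rewrite ger0_norm.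
move=> r T r01; have /andP[r0 r1] := r01.
set S := energy r M T; set S' := energy r M (T - H).
pose x i k := if (H <= k < T)%N then u i k else 0.
pose MT k := if (k < T)%N then M k else 0.
pose MH k := if (k < H.*2)%N then M k else 0.
pose ME k := if (T - H <= k < T)%N then M k else 0.
pose M2 k := MH k + ME k.
have MT0 k : 0 <= MT k by rewrite /MT; case: ifP.
have MH0 k : 0 <= MH k by rewrite /MH; case: ifP.
have ME0 k : 0 <= ME k by rewrite /ME; case: ifP.
have M20 k : 0 <= M2 k by rewrite addr_ge0.
pose N := (T + H)%N.
have TN : (T <= N)%N by rewrite leq_addr.
(* [MT] feeds the defect away from the cuts; [M2] is supported where a window
   meets one of the two cuts. *)
have EMT : energy r MT N <= S.
  rewrite /N; elim: (H) => [|h IH].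
    by rewrite addn0; apply: energy_le => // k kT; rewrite /MT kT ger0_norm.
  by rewrite addnS energyS {2}/MT ltnNge leq_addr /= mulr0 expr0n addr0.
have EMH T' : energy r MH T' <= C0.
  apply: le_trans (_ : energy r MH H.*2 <= _).
    elim: T' => [|t IH]; first by apply: energy_mono.
    have [tH|Ht] := leqP t.+1 H.*2; first exact: energy_mono.
    rewrite energyS {2}/MH ltnNge.
    by have -> : (H.*2 <= t)%N by [] ; rewrite /= mulr0 expr0n addr0.
  apply: ler_sum => k _; rewrite /MH ltn_ord expr1n mul1r exprMn ler_piMl ?sqr_ge0 //.
  by rewrite exprn_ile1 ?exprn_ge0 // exprn_ile1.
have EME : energy r ME N <= S - S'.
  apply: le_trans (_ : energy r ME T <= _).
    rewrite /N; elim: (H) => [|h IH]; first by rewrite addn0.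
    by rewrite addnS energyS {2}/ME [(_ < T)%N]ltnNge leq_addr andbF mulr0 expr0n addr0.
  rewrite lerBrDr /S /S'; have := leq_subr H T; set T' := (T - H)%N => T'T.
  suff : forall t, (T' <= t)%N -> (t <= T)%N -> energy r ME t + energy r M T' <= energy r M t.
    by apply.
  elim=> [|t IH].
    by rewrite leqn0 => /eqP -> _; rewrite /energy !big_ord0 addr0.
  rewrite leq_eqVlt => /orP[/eqP <- _|T't tT].
    have -> : energy r ME T' = 0.
      rewrite /energy big1 // => k _.
      by rewrite /ME leqNgt ltn_ord /= mulr0 expr0n.
    by rewrite add0r.
  rewrite !energyS {2}/ME tT andbT; have -> : (T' <= t)%N by [].
  have := IH T't (ltnW tT); lra.
have EM2 : energy r M2 N <= 2 * (C0 + (S - S')).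
  by apply: le_trans (energyD _ _ _ _) _; rewrite ler_wpM2l // lerD.
pose U := \sum_(k < N) \sum_i (r ^+ k * x i k) ^+ 2.
have xM i k : `|x i k| <= M k by rewrite /x; case: ifP => // _; rewrite normr0.
have pointwise i k : `|scheme a m delta x i k| <=
    e * lag 1 (window_sum m (window_sum m MT)) k + beta * window_sum m M2 k.
  have nn1 : 0 <= e * lag 1 (window_sum m (window_sum m MT)) k.
    rewrite mulr_ge0 // lag_ge0 // => k'; apply: window_sum_ge0 => k''.
    exact: window_sum_ge0.
  have beta0 : 0 <= beta.
    rewrite addr_ge0 ?invr_ge0 ?(ltW d0) // mulr_ge0 //.
    by apply: sumr_ge0 => i' _; apply: sumr_ge0.
  have nn2 : 0 <= beta * window_sum m M2 k by rewrite mulr_ge0 // window_sum_ge0.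
  have [/andP[Hk kT]|out] := boolP (H.*2 <= k < T)%N.
    have lagx i' d : (d <= H)%N -> lag d (x i') k = lag d (u i') k.
      move=> dH; rewrite /lag; case: ifP => // _; rewrite /x.
      have -> : (H <= k - d < T)%N; last by [].
      apply/andP; split; last by apply: leq_ltn_trans (leq_subr _ _) kT.
      rewrite leq_subRL; last by apply: leq_trans Hk; rewrite -addnn; apply: leq_trans dH (leq_addr _ _).
      by apply: leq_trans Hk; rewrite -addnn leq_add2r.
    have -> : scheme a m delta x i k = scheme a m delta u i k.
      rewrite /scheme -{1}[x i k]/(x i k) lagx //.
      have := lagx i 0%N (leq0n _); rewrite /lag subn0 /= => ->.
      by congr (_ + _); apply: eq_bigr => j _; rewrite -!/(lag _ _ _) !lagx // ltnW.
    apply: le_trans (uscheme _ _ Hk) _.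
    suff -> : lag 1 (window_sum m (window_sum m M)) k = lag 1 (window_sum m (window_sum m MT)) k.
      by rewrite lerDl.
    rewrite /lag; case: ifP => // _.
    apply: window_sum_causal => j jk; apply: window_sum_causal => l lj.
    rewrite /MT; have -> : (l < T)%N; last by [].
    by apply: leq_ltn_trans kT; apply: leq_trans lj (leq_trans jk (leq_subr _ _)).
  apply: le_trans (_ : beta * window_sum m M2 k <= _); last by rewrite lerDr.
  apply: (@scheme_le_window_sum _ _ _ _ _ _ _ H) => // [i' j'|i' d dH]; first exact: ltnW.
  rewrite /lag; case: ltnP => dk; first by rewrite normr0.
  have [kH|Hk] := ltnP k H.*2.
    apply: le_trans (xM _ _) _; rewrite /M2 /MH.
    by rewrite (leq_ltn_trans (leq_subr _ _) kH) lerDl.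
  have Tk : (T <= k)%N by move: out; rewrite Hk /= -leqNgt.
  rewrite /x; case: ifP => [/andP[h1 h2]|_]; last by rewrite normr0.
  apply: le_trans (uM _ _) _; rewrite /M2 /ME h2 andbT.
  have -> : (T - H <= k - d)%N by exact: leq_sub.
  by rewrite lerDr.
have Escheme i : energy r (scheme a m delta x i) N <=
    2 * (e ^+ 2 * th ^+ 4 * S + beta ^+ 2 * th ^+ 2 * (2 * (C0 + (S - S')))).
  apply: le_trans (energy_le r0 (fun k _ => pointwise i k)) _.
  apply: le_trans (energyD _ _ _ _) _; rewrite ler_wpM2l // lerD //.
    rewrite energyZ -mulrA ler_wpM2l ?sqr_ge0 //.
    apply: le_trans (energy_lag _ _ _ r01) _.
    apply: le_trans (energy_window_sum _ _ _ r01) _.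
    apply: le_trans (ler_wpM2l _ (energy_window_sum _ _ _ r01)) _; first exact: sqr_ge0.
    by rewrite -/th mulrA -exprD ler_wpM2l ?exprn_ge0.
  rewrite energyZ -mulrA ler_wpM2l ?sqr_ge0 //.
  apply: le_trans (energy_window_sum _ _ _ r01) _.
  by rewrite -/th ler_wpM2l ?sqr_ge0.
have cU : c ^+ 2 * U <= n%:R * (2 * (e ^+ 2 * th ^+ 4 * S + beta ^+ 2 * th ^+ 2 * (2 * (C0 + (S - S'))))).
  apply: le_trans (@scheme_energy R n a m delta c r x T N sb r01 _ _ _ _) _.
  - move=> k; rewrite /x; case: (H <= k < T)%N; [exact: u_mean | by rewrite big1].
  - by move=> i k Tk; rewrite /x [(k < T)%N]ltnNge Tk andbF.
  - by rewrite /N -{1}(addn0 T) ltn_add2l.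
  - by move=> i j; rewrite leq_add2l ltnW.
  rewrite exchange_big [leRHS]mulr_natl -[X in _ <= _ *+ X]card_ord -sumr_const.
  by apply: ler_sum => i _; exact: Escheme.
have EU : energy r (fun k => \sum_i `|x i k|) T <= n%:R * U.
  apply: le_trans (energy_sum _ _ _) _; rewrite card_ord ler_wpM2l // /U [leRHS]exchange_big /=.
  apply: ler_sum => i _; apply: le_trans (energy_mono r _ TN) _.
  by apply: ler_sum => k _ /=; rewrite !exprMn real_normK ?num_real.
have ES : S <= 2 * (C0 + 2 * (n%:R * U + e ^+ 2 * (th ^+ 2 * S))).
  apply: le_trans (_ : energy r (fun k => MH k + (\sum_i `|x i k| + e * window_sum m M k)) T <= _).
    apply: energy_le => // k kT; rewrite ger0_norm //.
    have nn1 : 0 <= \sum_i `|x i k| by apply: sumr_ge0.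
    have nn2 : 0 <= e * window_sum m M k by rewrite mulr_ge0 // window_sum_ge0.
    have [kH|Hk] := ltnP k H.
      have -> : MH k = M k.
        by rewrite /MH (leq_trans kH) // -addnn leq_addr.
      by rewrite lerDl addr_ge0.
    apply: le_trans (Mrec _ Hk) _; rewrite addrA lerD2r.
    rewrite (_ : \sum_i `|u i k| = \sum_i `|x i k|) ?lerDr //.
    by apply: eq_bigr => i _; rewrite /x Hk kT.
  apply: le_trans (energyD _ _ _ _) _; rewrite ler_wpM2l // lerD //.
  apply: le_trans (energyD _ _ _ _) _; rewrite ler_wpM2l // lerD //.
  by rewrite energyZ ler_wpM2l ?sqr_ge0 // energy_window_sum.
have S0 : 0 <= S by exact: energy_ge0.
have nU : n%:R * U <= n%:R ^+ 2 * (c ^+ 2)^-1 *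
   (2 * (e ^+ 2 * th ^+ 4 * S + beta ^+ 2 * th ^+ 2 * (2 * (C0 + (S - S'))))).
  move: cU; set X := 2 * (_ + _) => cU.
  have -> : n%:R ^+ 2 * (c ^+ 2)^-1 * X = n%:R * ((c ^+ 2)^-1 * (n%:R * X)) by ring.
  by rewrite ler_wpM2l // ler_pdivlMl.
have e4 := ler_wpM2r S0 esmall.
rewrite /C2.
set k2 := n%:R ^+ 2 * (c ^+ 2)^-1 in nU.
have ek : e ^+ 2 * (8 * n%:R ^+ 2 * (c ^+ 2)^-1 * th ^+ 4 + 4 * th ^+ 2) * S =
  8 * (k2 * (e ^+ 2 * th ^+ 4 * S)) + 4 * (e ^+ 2 * (th ^+ 2 * S)) by rewrite /k2; ring.
have -> : 32 * n%:R ^+ 2 * (c ^+ 2)^-1 * beta ^+ 2 * th ^+ 2 = 32 * (k2 * (beta ^+ 2 * th ^+ 2)).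
  by rewrite /k2; ring.
have k20 : 0 <= k2 * (beta ^+ 2 * th ^+ 2).
  apply: mulr_ge0; first by rewrite /k2 mulr_ge0 ?sqr_ge0.
  by apply: mulr_ge0; exact: sqr_ge0.
have SS' : 0 <= S - S' by rewrite subr_ge0 energy_mono // leq_subr.
rewrite ek in e4.
have : n%:R * U <= 2 * (k2 * (e ^+ 2 * th ^+ 4 * S)) + 4 * (k2 * (beta ^+ 2 * th ^+ 2)) * (C0 + (S - S')).
  by apply: le_trans nU _; rewrite le_eqVlt; apply/orP; left; apply/eqP; ring.
set P := n%:R * U in ES *; set Q := k2 * (e ^+ 2 * th ^+ 4 * S) in e4 *.
set V := e ^+ 2 * (th ^+ 2 * S) in ES e4 *; set W := k2 * (beta ^+ 2 * th ^+ 2) in k20 *.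
move=> hP.
have hS : S <= 4 * C0 + 32 * W * (C0 + (S - S')) by lra.
lra.
Qed.

(** * Sampling a solution *)

Lemma solution_increment (R : realType) (n : nat) (G : delay_graph R n) (x : R -> 'cV[R]_n)
    (i : 'I_n) (s t c e : R) :
  delay_solution G x -> 0 <= s -> s <= t ->
  (forall u, s <= u <= t -> `|delay_rhs G x u i - c| <= e) ->
  `|x t i 0 - x s i 0 - c * (t - s)| <= e * (t - s).
Proof.
move=> sol s0 st rhsc.
apply: (@ae_derive_mean_value _ (fun u => x u i 0) (fun u => delay_rhs G x u i)) => //.
  apply: (@abs_continuous_sub _ 0 (t + 1)) => //; first by lra.
  by apply: sol_abs_continuous sol _ _ _; lra.
move: (sol_equation sol); apply: filterS; first exact: (ae_filter_ringOfSetsType lebesgue_measure).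
  move=> u hu /andP[su _]; exact: hu (le_trans s0 su) i.
Qed.

(** The couplings cancel in pairs because weights and delays are symmetric. *)
Lemma solution_sum (R : realType) (n : nat) (G : delay_graph R n) (x : R -> 'cV[R]_n) (t : R) :
  delay_solution G x -> 0 <= t -> \sum_i x t i 0 = \sum_i x 0 i 0.
Proof.
move=> sol t0.
have rhs0 u : \sum_i delay_rhs G x u i = 0.
  pose S := \sum_i delay_rhs G x u i; rewrite -/S.
  suff : S = - S by lra.
  rewrite /S /delay_rhs {1}exchange_big -sumrN; apply: eq_bigr => i _.
  by rewrite -sumrN; apply: eq_bigr => j _; rewrite adj_sym delay_sym; ring.
have := @ae_derive_mean_value R (fun u => \sum_i x u i 0) (fun u => \sum_i delay_rhs G x u i) 0 t 0 0.
rewrite !mul0r subr0 normr_le0 subr_eq0 => h; apply/eqP/h => //.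
- apply: abs_continuous_sum => i; apply: (@abs_continuous_sub _ 0 (t + 1)) => //; first by lra.
  by apply: sol_abs_continuous sol _ _ _; lra.
- move: (sol_equation sol); apply: filterS; first exact: (ae_filter_ringOfSetsType lebesgue_measure).
  move=> u hu /andP[su _].
  have := @is_derive_sum _ _ _ n (fun i u => x u i 0) u 1 (fun i => delay_rhs G x u i) (hu su).
  by rewrite (_ : \sum_(i < n) _ = fun u => \sum_i x u i 0) //; apply/funext => u'; rewrite fct_sumE.
- by move=> u _; rewrite rhs0 subrr normr0.
Qed.

Lemma solution_bounded (R : realType) (n : nat) (G : delay_graph R n) (x : R -> 'cV[R]_n) (a b : R) :
  delay_solution G x -> 0 <= a -> a <= b ->
  exists B, forall t i, a <= t <= b -> `|x t i 0| <= B.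
Proof.
move=> sol a0 ab.
have bi i : exists B, forall t, a <= t <= b -> `|x t i 0| <= B.
  have cx : {within `[a, b], continuous (fun t => `|x t i 0|)}.
    have sub : `[a, b] `<=` `[0, +oo[%classic.
      by move=> t /=; rewrite !in_itv /= andbT => /andP[/(le_trans a0)].
    have cs := continuous_subspaceW sub (sol_continuous sol).
    move=> t; apply: (@cvg_comp _ _ _ (x : subspace `[a, b] -> 'cV[R]_n) (fun v => `|v i 0|)); first exact: cs.
    apply: (@cvg_comp _ _ _ (fun v : 'cV[R]_n => v i 0) (fun r => `|r|)); first exact: coord_continuous.
    exact: norm_continuous.
  have [c _ cmax] := EVT_max ab cx.
  by exists `|x c i 0| => t tab; apply: cmax; rewrite in_itv.
have [B hB] := choice bi.
exists (\sum_i `|B i|) => t i tab; apply: le_trans (hB i t tab) _.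
apply: le_trans (ler_norm _) _; rewrite (bigD1 i) //= lerDl; exact: sumr_ge0.
Qed.

Definition cell {R : realType} (delta : R) (k : nat) (t : R) : Prop :=
  k%:R * delta <= t <= k.+1%:R * delta.

Lemma cell_shift (R : realType) (delta tau : R) (m k : nat) (t : R) :
  0 < delta -> m%:R * delta <= tau -> tau < m.+1%:R * delta -> (m < k)%N ->
  cell delta k t -> cell delta (k - m) (t - tau) \/ cell delta (k - m.+1) (t - tau).
Proof.
move=> d0 m1 m2 mk /andP[t1 t2]; rewrite /cell.
have e1 : (k - m)%:R = k%:R - m%:R :> R by rewrite natrB // ltnW.
have e2 : (k - m.+1)%:R = k%:R - m.+1%:R :> R by rewrite natrB.
have e3 : (k - m.+1).+1%:R = k%:R - m%:R :> R by rewrite -subSn // subSS e1.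
have e4 : (k - m).+1%:R = k%:R - m%:R + 1 :> R by rewrite -natr1 e1.
rewrite e1 e2 e3 e4 -!natr1 in m1 m2 t1 t2 *.
have [h|h] := leP ((k%:R - m%:R) * delta) (t - tau); [left|right]; apply/andP; split; lra.
Qed.

Lemma cell_l (R : realType) (delta : R) (k : nat) : 0 < delta -> cell delta k (k%:R * delta).
Proof. by move=> d0; rewrite /cell lexx ler_pM2r // ler_nat leqnSn. Qed.

Lemma cell_r (R : realType) (delta : R) (k : nat) : 0 < delta -> cell delta k (k.+1%:R * delta).
Proof. by move=> d0; rewrite /cell lexx ler_pM2r // ler_nat leqnSn. Qed.

Definition grid_delay {R : realType} {n : nat} (G : delay_graph R n) (delta : R)
    (i j : 'I_n) : nat := Num.truncn (delay G i j / delta).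

(** Twice the total weight bounds the speed of a solution in terms of nearby values;
    adding 1 makes the constant at least 1, so that its square bounds it too. *)
Definition coupling {R : realType} {n : nat} (G : delay_graph R n) : R :=
  2 * \sum_i \sum_j `|adj G i j| + 1.

Lemma coupling_ge1 (R : realType) (n : nat) (G : delay_graph R n) : 1 <= coupling G.
Proof.
by rewrite lerDr mulr_ge0 //; do 2!apply: sumr_ge0 => ? _.
Qed.

Lemma coupling_row (R : realType) (n : nat) (G : delay_graph R n) (i : 'I_n) :
  2 * \sum_j `|adj G i j| <= coupling G.
Proof.
rewrite /coupling; have : \sum_j `|adj G i j| <= \sum_i \sum_j `|adj G i j|.
  by rewrite [leRHS](bigD1 i) //= lerDl; apply: sumr_ge0 => ? _; exact: sumr_ge0.
lra.
Qed.

Lemma grid_delayP (R : realType) (n : nat) (G : delay_graph R n) (delta : R) (i j : 'I_n) :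
  0 < delta ->
  (grid_delay G delta i j)%:R * delta <= delay G i j < (grid_delay G delta i j).+1%:R * delta.
Proof.
move=> d0; rewrite -ler_pdivlMr // -ltr_pdivrMr //; apply: truncn_itv.
by rewrite divr_ge0 ?delay_ge0 // ltW.
Qed.

(** With [M k] the supremum of [|y|] over the [k]-th cell, the equation bounds the
    oscillation of [y] on that cell by [delta * K * window_sum m M k]. This compares
    [M] with the samples. It also shows that the slope of [y] on a cell varies by at
    most [e] times the iterated window sum, the delayed times being within one cell of
    the grid points used by the scheme. The first cells are excluded because the
    history jumps at time 0. *)
Lemma solution_envelope (R : realType) (n : nat) (G : delay_graph R n)
    (x : R -> 'cV[R]_n) (mean delta : R) (H : nat) :
  let y i t := x t i 0 - mean in
  let u i (k : nat) := y i (k%:R * delta) in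
  let m := grid_delay G delta in
  let e := delta * coupling G ^+ 2 in
  delay_solution G x -> 0 < delta -> (forall i j, ((m i j).+2 <= H)%N) ->
  exists M : nat -> R, [/\ forall k, 0 <= M k,
    forall i k t, cell delta k t -> `|y i t| <= M k,
    forall k, (H <= k)%N -> M k <= \sum_i `|u i k| + e * window_sum m M k &
    forall i k, (H.*2 <= k)%N ->
      `|scheme (adj G) m delta u i k| <= e * lag 1 (window_sum m (window_sum m M)) k].
Proof.
move=> y u m e sol d0 mH; set K := coupling G in e *.
have K1 : 1 <= K by exact: coupling_ge1.
have K0 : 0 < K by exact: lt_le_trans K1.
have e0 : 0 <= e by rewrite mulr_ge0 ?(ltW d0) // sqr_ge0.
have mP i j := grid_delayP G i j d0.
have Kle : delta * K <= e by rewrite /e expr2 ler_wpM2l ?(ltW d0) // ler_peMr // ltW.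
pose cellv k := [set v : R | exists i t, cell delta k t /\ v = `|y i t|].
pose M k := sup (cellv k).
have cell0 k t : cell delta k t -> 0 <= t.
  by move=> /andP[+ _]; apply: le_trans; rewrite mulr_ge0 // ltW.
have cellv_ub k : has_ubound (cellv k).
  have [||B hB] := @solution_bounded _ _ _ _ (k%:R * delta) (k.+1%:R * delta) sol.
  - by rewrite mulr_ge0 // ltW.
  - by rewrite ler_pM2r // ler_nat.
  exists (B + `|mean|) => _ [i [t [tk ->]]].
  by apply: le_trans (ler_normB _ _) _; rewrite lerD2r hB.
have yM i k t : cell delta k t -> `|y i t| <= M k.
  by move=> tk; apply: ub_le_sup => //; exists i, t.
have M_le k B : 0 <= B -> (forall i t, cell delta k t -> `|y i t| <= B) -> M k <= B.
  move=> B0 h; rewrite /M; have [/set0P ne|] := boolP (cellv k != set0).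
    by apply: ge_sup => // _ [i [t [tk ->]]]; exact: h.
  by rewrite negbK => /eqP ->; rewrite sup0.
have M0 k : 0 <= M k.
  have [/set0P[_ [i [t [tk _]]]]|] := boolP (cellv k != set0).
    by apply: le_trans (yM i _ _ tk).
  by rewrite negbK /M => /eqP ->; rewrite sup0.
have ylag i j l k t : (H <= k)%N -> cell delta k t ->
    `|y l (t - delay G i j)| <= lag (m i j) M k + lag (m i j).+1 M k.
  move=> Hk tk; have /andP[h1 h2] := mP i j.
  have mk : (m i j < k)%N by apply: leq_trans Hk; apply: ltnW; exact: mH.
  rewrite /lag [(k < _)%N]ltnNge (ltnW mk) /= ltnNge mk /=.
  have [ck|ck] := cell_shift d0 h1 h2 mk tk.
    by apply: le_trans (yM _ _ _ ck) _; rewrite lerDl.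
  by apply: le_trans (yM _ _ _ ck) _; rewrite lerDr.
have rhsE t i : delay_rhs G x t i =
    \sum_j adj G i j * (y j (t - delay G i j) - y i (t - delay G i j)).
  by apply: eq_bigr => j _; rewrite /y; congr (_ * _); ring.
have adj_row := coupling_row G.
have osc i k s t : (H <= k)%N -> cell delta k s -> cell delta k t -> s <= t ->
    `|y i t - y i s| <= delta * K * window_sum m M k.
  move=> Hk sk tk st.
  have W0 : 0 <= window_sum m M k by exact: window_sum_ge0.
  have := @solution_increment _ _ _ _ i s t 0 (K * window_sum m M k) sol (cell0 _ _ sk) st.
  rewrite mul0r subr0 (_ : x t i 0 - x s i 0 = y i t - y i s); last by rewrite /y; ring.
  move=> h; apply: le_trans (h _) _ => [w /andP[sw wt]|].
    have wk : cell delta k w.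
      move: sk tk => /andP[h1 _] /andP[_ h2]; rewrite /cell.
      by rewrite (le_trans h1 sw) (le_trans wt h2).
    rewrite subr0 rhsE; apply: le_trans (ler_norm_sum _ _ _) _.
    apply: le_trans (_ : \sum_j `|adj G i j| * (2 * window_sum m M k) <= _).
      apply: ler_sum => j _; rewrite normrM ler_wpM2l //.
      apply: le_trans (ler_normB _ _) _.
      have := ylag i j j k w Hk wk; have := ylag i j i k w Hk wk.
      have := window_sum_ge m k i j M0; lra.
    by rewrite -mulr_suml mulrCA mulrA ler_wpM2r.
  rewrite mulrC mulrA ler_wpM2r // ler_wpM2r ?(ltW K0) //.
  by move: sk tk => /andP[h1 _] /andP[_]; rewrite -natr1; lra.
exists M; split => //.
- move=> k Hk; apply: M_le => [|i t tk].
    by apply: addr_ge0; [exact: sumr_ge0 | rewrite mulr_ge0 // window_sum_ge0].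
  have -> : y i t = (y i t - y i (k%:R * delta)) + u i k by rewrite /u; ring.
  apply: le_trans (ler_normD _ _) _; rewrite addrC lerD //.
    by rewrite (bigD1 i) //= lerDl; exact: sumr_ge0.
  apply: le_trans (osc _ _ _ _ Hk (cell_l k d0) tk _) _; first by have /andP[] := tk.
  by rewrite ler_wpM2r // window_sum_ge0.
- move=> i [|k] Hk; first by have := mH i i; lia.
  set W := window_sum m M; set WW := window_sum m W.
  have W0 k' : 0 <= W k' by exact: window_sum_ge0.
  have -> : lag 1 WW k.+1 = WW k by rewrite /lag /= subn1.
  have Hk0 : (H <= k)%N by have := mH i i; lia.
  pose slope := \sum_j adj G i j * (u j (k.+1 - m i j)%N - u i (k.+1 - m i j)%N).
  have schemeE : scheme (adj G) m delta u i k.+1 = delta^-1 * (u i k.+1 - u i k) - slope.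
    rewrite /scheme /slope -sumrN; congr (_ + _); first by rewrite /lag /= subn1.
    apply: eq_bigr => j _; rewrite /lag [(k.+1 < _)%N]ltnNge.
    have -> /= : (m i j <= k.+1)%N by have := mH i j; lia.
    by ring.
  have near_grid j l t : cell delta k t ->
      `|y l (t - delay G i j) - u l (k.+1 - m i j)%N| <= delta * K * WW k.
    move=> tk; have /andP[h1 h2] := mP i j.
    have mk : (m i j < k)%N by apply: leq_trans Hk0; apply: ltnW; exact: mH.
    have Hk1 : (H <= k - (m i j).+1)%N.
      by have := mH i j; lia.
    have Hk2 : (H <= k - m i j)%N by apply: leq_trans Hk1 _; exact: leq_sub2l.
    have wsum := window_sum_ge m k i j W0.
    rewrite /lag [(k < _)%N]ltnNge (ltnW mk) /= [(k < _)%N]ltnNge mk /= in wsum.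
    apply: le_trans (_ : delta * K * (W (k - m i j)%N + W (k - (m i j).+1)%N) <= _); last first.
      by rewrite ler_wpM2l // mulr_ge0 // ltW.
    have dK0 : 0 <= delta * K by rewrite mulr_ge0 // ltW.
    have gridE : u l (k.+1 - m i j)%N = y l ((k - m i j).+1%:R * delta).
      by rewrite /u subSn // ltnW.
    rewrite gridE distrC.
    have [ck|ck] := cell_shift d0 h1 h2 mk tk.
      apply: le_trans (osc _ _ _ _ Hk2 ck (cell_r _ d0) _) _; first by have /andP[] := ck.
      by rewrite ler_wpM2l // lerDl.
    (* The delayed time is one cell to the left of the grid point: compare both with
       the common end point [s]. *)
    set s := (k - m i j)%:R * delta.
    have sl : cell delta (k - m i j) s by exact: cell_l.
    have sr : cell delta (k - (m i j).+1) s.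
      have -> : s = (k - (m i j).+1).+1%:R * delta by rewrite /s -subSn // subSS.
      exact: cell_r.
    have -> : y l ((k - m i j).+1%:R * delta) - y l (t - delay G i j) =
       (y l ((k - m i j).+1%:R * delta) - y l s) + (y l s - y l (t - delay G i j)) by ring.
    apply: le_trans (ler_normD _ _) _; rewrite mulrDr lerD //.
      by apply: osc => //; [exact: cell_r | rewrite /s ler_pM2r // ler_nat].
    apply: osc => //; move: ck => /andP[_]; rewrite -subSn // subSS; exact.
  have slope_close t : cell delta k t -> `|delay_rhs G x t i - slope| <= e * WW k.
    move=> tk; rewrite rhsE /slope -sumrB; apply: le_trans (ler_norm_sum _ _ _) _.
    apply: le_trans (_ : \sum_j `|adj G i j| * (2 * (delta * K * WW k)) <= _).
      apply: ler_sum => j _; rewrite -mulrBr normrM ler_wpM2l //.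
      have := near_grid j j t tk; have := near_grid j i t tk.
      set p := y i _; set q := y j _; set p' := u i _; set q' := u j _ => hp hq.
      have -> : q - p - (q' - p') = (q - q') - (p - p') by ring.
      by apply: le_trans (ler_normB _ _) _; lra.
    have -> : e * WW k = K * (delta * K * WW k) by rewrite /e; ring.
    rewrite -mulr_suml mulrCA mulrA ler_wpM2r //.
    by rewrite !mulr_ge0 ?(ltW d0) ?(ltW K0) // window_sum_ge0.
  have stepd : k.+1%:R * delta - k%:R * delta = delta by rewrite -natr1; ring.
  have kd0 : 0 <= k%:R * delta by rewrite mulr_ge0 // ltW.
  have kkd : k%:R * delta <= k.+1%:R * delta by rewrite ler_pM2r // ler_nat.
  have := solution_increment sol kd0 kkd slope_close.
  rewrite stepd (_ : x _ i 0 - x _ i 0 = u i k.+1 - u i k); last by rewrite /u /y; ring.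
  rewrite schemeE => h.
  have -> : delta^-1 * (u i k.+1 - u i k) - slope =
    delta^-1 * (u i k.+1 - u i k - slope * delta) by field; exact: lt0r_neq0.
  by rewrite normrM gtr0_norm ?invr_gt0 // ler_pdivrMl // [leRHS]mulrC.
Qed.

(** * Consensus *)

Theorem theorem2 (R : realType) (n : nat) (G : delay_graph R n)
    (hL0 : psd (L0 G)) (hL0_simple : simple_zero_eigenvalue (L0 G))
    (hLtau : psd (L_tau G)) (hLtau_simple : simple_zero_eigenvalue (L_tau G)) :
  reaches_average_consensus G.
Proof.
move=> x0 x sol x_init.
have [c [delta0 [c0 d00 symb]]] := symbol_bound hLtau hLtau_simple.
pose K := coupling G.
have K0 : 0 < K by exact: lt_le_trans (coupling_ge1 G).
pose th : R := 2 * n%:R ^+ 2.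
pose Const : R := 8 * n%:R ^+ 2 * (c ^+ 2)^-1 * th ^+ 4 + 4 * th ^+ 2.
have Const0 : 0 <= Const.
  have th0 : 0 <= th by rewrite mulr_ge0 // sqr_ge0.
  have ci0 : 0 <= (c ^+ 2)^-1 by rewrite invr_ge0 sqr_ge0.
  by rewrite addr_ge0 // ?mulr_ge0 ?exprn_ge0.
(* This makes [e = delta * K ^+ 2] at most [1 / (1 + 2 * Const)]. *)
pose delta := Num.min delta0 (K ^+ 2 * (1 + 2 * Const))^-1.
have den0 : 0 < K ^+ 2 * (1 + 2 * Const) by rewrite mulr_gt0 ?exprn_gt0 // ltr_wpDr ?mulr_ge0.
have d0 : 0 < delta by rewrite lt_min d00 invr_gt0.
have dd0 : delta <= delta0 by rewrite ge_min lexx.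
pose e := delta * K ^+ 2.
have e0 : 0 <= e by rewrite mulr_ge0 ?(ltW d0) // sqr_ge0.
have eC : e * (1 + 2 * Const) <= 1.
  by rewrite /e -mulrA -ler_pdivlMr // div1r ge_min lexx orbT.
have esmall : e ^+ 2 * Const <= 2^-1.
  have e1 : e <= 1.
    apply: le_trans eC; rewrite ler_peMr // lerDl mulr_ge0 //.
  have eC0 : 0 <= e * Const by rewrite mulr_ge0.
  have : e ^+ 2 * Const <= e * Const by rewrite expr2 -mulrA ler_piMl.
  lra.
pose m := grid_delay G delta.
have mP i j := grid_delayP G i j d0.
(* Any common bound of the delays works; one step is for the rounding and one for
   the difference quotient. *)
pose H := (\sum_i \sum_j m i j).+2.
have mH i j : ((m i j).+2 <= H)%N.
  by rewrite /H !ltnS (bigD1 i) //= (bigD1 j) //= -addnA leq_addr.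
pose mean : R := n%:R^-1 * \sum_i x0 i 0.
pose y i t := x t i 0 - mean.
have y_mean t : 0 <= t -> \sum_i y i t = 0.
  move=> t0; rewrite /y sumrB (solution_sum sol) // x_init sumr_const card_ord.
  rewrite -[mean *+ n]mulr_natl /mean mulrA.
  have [/eqP|nN0] := eqVneq (n%:R : R) 0; last by rewrite mulfV // mul1r subrr.
  rewrite pnatr_eq0 => /eqP n0; rewrite !big1 ?mulr0 ?subrr // => i _;
    by have := ltn_ord i; rewrite {2}n0.
have [M [M0 yM Mrec uscheme]] := solution_envelope mean sol d0 mH.
have MtoZero : M @ \oo --> (0 : R).
  have [H0 mH'] : (0 < H)%N /\ forall i j, (m i j < H)%N by split=> // i j; exact: ltnW.
  apply: (@discrete_decay R n (adj G) m delta c e H (fun i k => y i (k%:R * delta)) M) => //.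
  - move=> w v w1 v0; apply: symb => // i j; first by have /andP[] := mP i j.
    by rewrite /m /grid_delay delay_sym.
  - by move=> i; rewrite /m /grid_delay delay_nonedge ?edge_irr // mul0r truncn0.
  - by move=> k; rewrite y_mean // mulr_ge0 // ltW.
  - by move=> i k; apply: yM; exact: cell_l.
  - by move=> i k; apply: yM; exact: cell_r.
apply/cvgrPdist_le => eps eps0.
have /cvgrPdist_le/(_ _ eps0)[k0 _ hk0] := MtoZero.
near=> t.
have t0 : 0 <= t by near: t; exact: nbhs_pinfty_ge.
have k0t : k0%:R * delta <= t by near: t; apply: nbhs_pinfty_ge; exact: num_real.
pose k := Num.truncn (t / delta).
have /andP[h1 h2] : k%:R <= t / delta < k.+1%:R.
  by apply: truncn_itv; rewrite divr_ge0 // ltW.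
have tk : cell delta k t by rewrite /cell -ler_pdivlMr // h1 -ler_pdivrMr // ltW.
have kk0 : (k0 <= k)%N.
  rewrite -ltnS -(ltr_nat R); apply: le_lt_trans h2; rewrite ler_pdivlMr //.
apply: mx_norm_le => [|i j]; first exact: ltW.
rewrite ord1 !mxE distrC; apply: le_trans (yM i k t tk) _.
have := hk0 k kk0; by rewrite /= sub0r normrN ger0_norm.
Unshelve. all: by end_near. Qed.
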